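(* Let $Y$ be a $\mathbb{Z}$-valued random variable with $\mathbb{P}(Y=k)=\frac{1}{G}\operatorname{sech}\left(\frac{\pi}{2}(2k+1)\right)$ for $k\in\mathbb{Z}$. Then \begin{align*} (i)\quad &\mathbb{E}\left[(2Y+1)^2\right]=2G^2,\\ (ii)\quad &\mathbb{E}\left[(2Y+1)^4\right]=12G^4,\\ (iii)\quad &\mathbb{E}\left[(2Y+1)^6\right]=216G^6,\\ (iv)\quad &\mathbb{E}\left[(2Y+1)^8\right]=7056G^8. \end{align*}
   Context: $\operatorname{sech}(x)=1/\cosh(x)$. $\varpi=\Gamma^2(1/4)/(2\sqrt{2\pi})$ is the lemniscate constant and $G=\varpi/\pi$ is Gauss' constant. The given law is a probability distribution on $\mathbb{Z}$, i.e. $\sum_{k\in\mathbb{Z}}\operatorname{sech}\left(\frac{\pi}{2}(2k+1)\right)=G$; it is called the second discrete bilateral hyperbolic secant distribution $\mathsf{Sech}_{2,b}$. *)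

(* Defs.v *)
From HB Require Import structures.
From mathcomp Require Import all_boot all_order all_algebra.
From mathcomp Require Import all_classical all_reals all_analysis.

Set Implicit Arguments.
Unset Strict Implicit.
Unset Printing Implicit Defensive.

Import Order.TTheory GRing.Theory Num.Theory.
Import numFieldNormedType.Exports.

Local Open Scope classical_set_scope.
Local Open Scope ring_scope.

(* The power-set sigma-algebra on int, as the library does for nat. *)
HB.instance Definition _ := isPointed.Build int 0.
HB.instance Definition _ := @isMeasurable.Build default_measure_display
  int discrete_measurable discrete_measurable0
  discrete_measurableC discrete_measurableU.

Section definitions.
Context {R : realType}.
Implicit Type x : R.

Definition cosh x : R := (expR x + expR (- x)) / 2.

Definition sech x : R := (cosh x)^-1.

(* Euler's integral; only meaningful for 0 < x. *)
Definition Gamma x : R :=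
  \int[lebesgue_measure]_(t in `]0, +oo[) (t `^ (x - 1) * expR (- t)).

End definitions.

Definition lemniscate (R : realType) : R :=
  Gamma (1 / 4) ^+ 2 / (2 * Num.sqrt (2 * pi)).

Definition gauss (R : realType) : R := lemniscate R / pi.

(* Main.v *)
(* By additivity P has total mass 1, so Gauss' constant equals the sum of the
   a_k = sech(pi/2 (2k+1)), whatever the value of Gamma(1/4). Telescoping sums
   of hyperbolic tangents evaluate the threefold convolution of a as
   a_k ((2k+1)^2 + L) / 2 with a constant L, which says that
   F(t) = sum a_k cos((2k+1)t) and f(t) = sum a_k exp((2k+1)t) solve
   F'' = L F - 2 F^3 and f'' = -L f + 2 f^3. Now F vanishes at pi/2, which is
   also where f blows up, while F(0) = f(0): the real and the imaginary quarter
   periods of the underlying elliptic function agree. Comparing F with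
   F(0)^2 / f on [0, pi/2] then forces L = 0, and differentiating f'' = 2 f^3
   at 0 yields the moments. *)
Require Import Defs.
From mathcomp Require Import all_boot all_order all_algebra zify ring lra.
From mathcomp Require Import all_classical all_reals all_analysis.
From mathcomp Require Import measurable_realfun.

Set Implicit Arguments.
Unset Strict Implicit.
Unset Printing Implicit Defensive.

Import Order.TTheory GRing.Theory Num.Theory.
Import numFieldNormedType.Exports.

Local Open Scope classical_set_scope.
Local Open Scope ring_scope.

(** * Comparison of the two quarter periods *)

(** By the symmetry k -> -k-1 of the sequence, f(t) = F(it), which is why the two equations differ
    only in signs. In the comparison the sign of L is reversed with respect to the overview. Writing
    G = F(0), the first integrals are F'^2 = (G^2 - F^2)(G^2 + F^2 + L) and f'^2 = (f^2 - G^2)(f^2 +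
    G^2 + L). Passing to u = G^2 / f turns the pole of f into a zero, and u satisfies the first
    integral of F exactly when L = 0. At equal height x the squared speeds of F and u differ by L
    (G^2 - x^2)^2 / G^2. So for nonzero L one of the two is always the faster one, and they cannot
    both need the time pi/2 to fall from G to 0. Comparing arrival times directly would involve
    improper integrals, and both speeds vanish at the start. The contradiction is therefore reached
    pointwise: an interior extremum argument settles the sign of F - u, and this sign fixes that of
    the derivative of the Wronskian of F and u, which vanishes at both ends. *)

Section derivation_rules.
Context {R : realType}.
Implicit Types (f g : R -> R) (x a b c : R) (n : nat).

Lemma is_deriveC x c : is_derive x 1 (fun=> c) 0.
Proof. exact: is_derive_cst. Qed.

Lemma is_deriveI x : is_derive x 1 (fun y : R => y) 1.
Proof. exact: is_derive_id. Qed.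

Lemma is_derive_add f g x a b : is_derive x 1 f a -> is_derive x 1 g b ->
  is_derive x 1 (fun y => f y + g y) (a + b).
Proof. exact: is_deriveD. Qed.

Lemma is_derive_opp f x a : is_derive x 1 f a ->
  is_derive x 1 (fun y => - f y) (- a).
Proof. exact: is_deriveN. Qed.

Lemma is_derive_mul f g x a b : is_derive x 1 f a -> is_derive x 1 g b ->
  is_derive x 1 (fun y => f y * g y) (f x * b + g x * a).
Proof. exact: is_deriveM. Qed.

Lemma is_derive_inv f x a : f x != 0 -> is_derive x 1 f a ->
  is_derive x 1 (fun y => (f y)^-1) (- f x ^- 2 * a).
Proof. exact: is_deriveV. Qed.

Lemma is_derive_exp f x a n : is_derive x 1 f a ->
  is_derive x 1 (fun y => f y ^+ n) (n%:R * f x ^+ n.-1 * a).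
Proof.
move=> fa; have := is_deriveX n fa; congr is_derive.
by apply/funext => y; rewrite exprfctE.
Qed.

Lemma is_derive_continuous f x a : is_derive x 1 f a -> {for x, continuous f}.
Proof.
move=> [fx _]; apply: differentiable_continuous.
by apply/derivable1_diffP.
Qed.

End derivation_rules.

(** Derivatives found in the context act as additional rules, so facts about abstract functions are
    first put there with [have]. What usually remains is an equation between two expressions of the
    derivative, left to [ring] or [field]. *)
Ltac derive := apply: is_derive_eq; repeat first
  [ eassumption | apply: is_deriveC | apply: is_deriveI | apply: is_derive_exp
  | apply: is_derive_opp | apply: is_derive_mul | apply: is_derive_add
  | apply: is_derive_inv ]; rewrite /GRing.scale /=.

(** At an interior minimum with nonpositive value the slope would be 0, against the hypothesis on
    [dD]. If the minimum is attained only at an end, its value is 0, and a point [t] with [D t <= 0]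
    is then itself an interior minimum. *)
Lemma pos_of_neg_slope (R : realType) (T : R) (D dD : R -> R) : 0 < T ->
  {within `[0, T], continuous D} -> D 0 = 0 -> D T = 0 ->
  (forall t : R, 0 < t < T -> is_derive t 1 D (dD t)) ->
  (forall t : R, 0 < t < T -> D t <= 0 -> dD t < 0) ->
  forall t : R, 0 < t < T -> 0 < D t.
Proof.
move=> T0 cD D0 DT dDP neg t tT; rewrite ltNge; apply/negP => Dt.
have nomin c : 0 < c < T -> D c <= 0 ->
    ~ (forall x, x \in `]0, T[ -> D c <= D x).
  move=> cT Dc mc; have := neg c cT Dc.
  have dD' x : x \in `]0, T[ -> derivable D x 1.
    by rewrite in_itv/= => xT; have [] := dDP x xT.
  have [_ <-] := dDP c cT.
  have cT' : c \in `]0, T[ by rewrite in_itv.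
  by have [_ ->] := derive1_at_min (ltW T0) dD' cT' mc; rewrite ltxx.
have [c] := EVT_min (ltW T0) cD.
have sub x : x \in `]0, T[ -> x \in `[0, T] by rewrite !in_itv/= => /andP[/ltW -> /ltW ->].
have tT' : t \in `]0, T[ by rewrite in_itv.
rewrite in_itv/= => /andP[c0 cT] mc.
have [cin|cout] := boolP (0 < c < T).
  apply: (nomin c) => //; last by move=> x /sub; exact: mc.
  by rewrite (le_trans _ Dt)// mc// sub.
have Dc : D c = 0.
  move: c0 cT cout; rewrite le_eqVlt => /predU1P[<- //|->].
  by rewrite le_eqVlt => /predU1P[-> //|->].
apply: (nomin t) => // x xT.
by rewrite (le_trans Dt)// -Dc mc// sub.
Qed.

(** On the right half of the interval [V] stays above [V (T / 2)], which is positive, so no upper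
    bound of [V] can tend to 0. Working with a bound [h] suits the Wronskian, whose factor [u1] is
    controlled only before [T]. *)
Lemma increasing_not_vanishing (R : realType) (T : R) (V dV h : R -> R) : 0 < T ->
  V 0 = 0 -> (forall t : R, 0 <= t < T -> is_derive t 1 V (dV t)) ->
  (forall t : R, 0 < t < T -> 0 < dV t) ->
  (forall t : R, 0 < t < T -> V t <= h t) -> ~ h t @[t --> T^'-] --> 0.
Proof.
move=> T0 V0 dVP dV_gt0 Vh h0.
have incr a b : 0 <= a -> a < b -> b < T -> V a < V b.
  move=> a0 ab bT.
  have dVab (x : R) : x \in `]a, b[ -> is_derive x 1 V (dV x).
    rewrite in_itv/= => /andP[ax xb]; apply: dVP.
    by rewrite (le_trans a0 (ltW ax)) (lt_trans xb).
  have cV : {within `[a, b], continuous V}.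
    apply: derivable_within_continuous => x; rewrite in_itv/= => /andP[ax xb].
    have xT : 0 <= x < T by rewrite (le_trans a0) ?(le_lt_trans xb).
    by have [] := dVP x xT.
  have [c] := MVT ab dVab cV; rewrite in_itv/= => /andP[ac cb] e.
  by rewrite -subr_gt0 e mulr_gt0 ?subr_gt0// dV_gt0// (le_lt_trans a0)// (lt_trans cb).
have s0 : 0 < T / 2 by lra.
have sT : T / 2 < T by lra.
have Vs : 0 < V (T / 2) by rewrite -V0 incr.
have : \forall t \near T^'-, False.
  near=> t.
  have tT : t < T by near: t; exact: nbhs_left_lt.
  have st : T / 2 < t by near: t; exact: nbhs_left_gt.
  have : V t <= h t by apply: Vh; rewrite tT (lt_trans s0).
  have := incr _ _ (ltW s0) st tT.
  have : `|0 - h t| < V (T / 2).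
    by near: t; apply: (cvgrPdist_lt _ _).1 h0 _ Vs.
  by rewrite sub0r normrN; have := ler_norm (h t); lra.
by move=> /filter_ex[].
Unshelve. all: by end_near. Qed.

Section quarter_period.
Context {R : realType}.
Variables (T G L : R) (F F1 f f1 : R -> R).
Hypotheses (T_gt0 : 0 < T) (G_gt0 : 0 < G).
Hypothesis F_drv : forall t : R, is_derive t 1 F (F1 t).
Hypothesis F1_drv : forall t : R, is_derive t 1 F1 (- (L * F t) - 2 * F t ^+ 3).
Hypothesis f_drv : forall t : R, 0 <= t < T -> is_derive t 1 f (f1 t).
Hypothesis f1_drv :
  forall t : R, 0 <= t < T -> is_derive t 1 f1 (L * f t + 2 * f t ^+ 3).
Hypotheses (F0 : F 0 = G) (F10 : F1 0 = 0) (f0 : f 0 = G) (f10 : f1 0 = 0).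
Hypothesis FT : F T = 0.
Hypothesis F_lt : forall t, 0 < t <= T -> F t ^+ 2 < G ^+ 2.
Hypothesis f1_gt0 : forall t, 0 < t < T -> 0 < f1 t.
Hypothesis f_blowup : (f t)^-1 @[t --> T^'-] --> 0.

(** First integral of the second-order equation, with its constant fixed by the initial data
    [F 0 = G] and [F1 0 = 0]; these also make [G ^+ 2] a root, whence the factorisation. *)
Let F_energy (t : R) : F1 t ^+ 2 = (G ^+ 2 - F t ^+ 2) * (G ^+ 2 + F t ^+ 2 + L).
Proof.
pose E (x : R) := F1 x ^+ 2 - (G ^+ 2 - F x ^+ 2) * (G ^+ 2 + F x ^+ 2 + L).
suff : E t = E 0 by rewrite /E F0 F10 subrr; move=> h; lra.
apply: is_derive_0_is_cst => x; rewrite /E.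
have Fx := F_drv x; have F1x := F1_drv x.
by derive; ring.
Qed.

Let f_energy (t : R) : 0 <= t < T ->
  f1 t ^+ 2 = (f t ^+ 2 - G ^+ 2) * (f t ^+ 2 + G ^+ 2 + L).
Proof.
move=> /andP[]; rewrite le_eqVlt => /predU1P[<- _|t0 tT].
  by rewrite f10 f0 subrr mul0r expr0n.
pose E (x : R) := f1 x ^+ 2 - (f x ^+ 2 - G ^+ 2) * (f x ^+ 2 + G ^+ 2 + L).
have dE (x : R) : 0 <= x < T -> is_derive x 1 E 0.
  by move=> xT; rewrite /E; have fx := f_drv xT; have f1x := f1_drv xT;
     derive; ring.
have [||c _] := @MVT _ E (fun=> 0) 0 t t0.
- by move=> x; rewrite in_itv/= => /andP[x0 xt]; apply: dE; rewrite ltW//= (lt_trans xt).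
- apply: derivable_within_continuous => x; rewrite in_itv/= => /andP[x0 xt].
  have xT : 0 <= x < T by rewrite x0 (le_lt_trans xt).
  by have [] := dE x xT.
by rewrite mul0r /E f0 f10 subrr => h; lra.
Qed.

(** The first integral at [T], where [F] vanishes, gives the weak inequality. Equality is the
    separatrix, on which [F] never reaches 0: there F'^2 = F^2 (G^2 - F^2), hence |F'| <= G |F|, so
    that F^2 exp(2Gx) is nondecreasing and cannot drop from G^2 to 0. *)
Let GL_gt0 : 0 < G ^+ 2 + L.
Proof.
have : 0 <= G ^+ 2 + L.
  have : 0 <= G ^+ 2 * (G ^+ 2 + L).
    by have := sqr_ge0 (F1 T); rewrite F_energy FT expr0n/= subr0 addr0.
  by rewrite pmulr_rge0// exprn_gt0.
rewrite le_eqVlt => /predU1P[GL|//]; exfalso.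
pose H (x : R) := F x ^+ 2 * expR (2 * G * x).
pose H1 (x : R) := (2 * F x * F1 x + 2 * G * F x ^+ 2) * expR (2 * G * x).
have dH (x : R) : is_derive x 1 H (H1 x).
  have Fx := F_drv x.
  have ex : is_derive x 1 (fun y : R => expR (2 * G * y)) (2 * G * expR (2 * G * x)).
    have gx : is_derive x 1 (fun y : R => 2 * G * y) (2 * G) by derive; ring.
    by apply: is_derive_eq; rewrite /GRing.scale/=; ring.
  by rewrite /H /H1; derive; ring.
have H1_ge0 x : 0 <= H1 x.
  rewrite /H1 pmulr_lge0 ?expR_gt0//.
  have E := F_energy x; have -> : 2 * F x * F1 x + 2 * G * F x ^+ 2 =
    2 * (F x * F1 x + G * F x ^+ 2) by ring.
  rewrite pmulr_rge0//.
  have h : `|F x * F1 x| <= G * F x ^+ 2.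
    rewrite -(@ler_pXn2r _ 2)// ?nnegrE ?normr_ge0//; last first.
      by rewrite mulr_ge0 ?sqr_ge0// ltW.
    rewrite real_normK ?num_real// !exprMn E.
    have -> : L = - G ^+ 2 by lra.
    have h4 := sqr_ge0 (F x ^+ 2 * F x).
    by nra.
  by have := ler_norm (- (F x * F1 x)); rewrite normrN; lra.
have cH : {within `[0, T], continuous H}.
  by apply: derivable_within_continuous => x _; have [] := dH x.
have [c _] := MVT T_gt0 (fun x _ => dH x) cH.
rewrite subr0 /H FT F0 mulr0 expR0 expr0n/= mul0r mulr1 => e.
have := mulr_ge0 (H1_ge0 c) (ltW T_gt0); rewrite -e.
by have := exprn_gt0 2 G_gt0; lra.
Qed.

(** Both factors of the first integral are positive on ]0, T], so [F1] has no zero there. Since [F]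
    falls from [G] to 0, [F1] is negative somewhere, and by the intermediate value theorem
    everywhere. *)
Let F1_lt0 t : 0 < t <= T -> F1 t < 0.
Proof.
have F1_neq0 s : 0 < s <= T -> F1 s != 0.
  move=> sT; rewrite -sqrf_eq0 F_energy mulf_neq0 ?gt_eqF//.
    by rewrite subr_gt0 F_lt.
  by have := sqr_ge0 (F s); have := GL_gt0; lra.
have cF : {within `[0, T], continuous F}.
  by apply: derivable_within_continuous => x _; have [] := F_drv x.
have [c] := MVT T_gt0 (fun x _ => F_drv x) cF.
rewrite in_itv/= FT F0 subr0 => /andP[c0 cT] e.
have F1c : F1 c < 0.
  by rewrite -(pmulr_llt0 _ T_gt0) -e sub0r oppr_lt0.
move=> tT; rewrite ltNge; apply/negP => F1t.
have cF1 a b : {within `[a, b], continuous F1}.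
  by apply: derivable_within_continuous => x _; have [] := F1_drv x.
case/andP: tT => t0 tT.
have [ct|tc] := leP c t.
- have [|x] := @IVT _ F1 c t 0 ct (cF1 _ _).
    by rewrite ge_min le_max (ltW F1c) F1t orbT.
  rewrite in_itv/= => /andP[cx xt] /eqP; apply/negP.
  by apply: F1_neq0; rewrite (lt_le_trans c0)//= (le_trans xt).
- have [|x] := @IVT _ F1 t c 0 (ltW tc) (cF1 _ _).
    by rewrite ge_min le_max (ltW F1c) F1t orbT.
  rewrite in_itv/= => /andP[tx xc] /eqP; apply/negP.
  by apply: F1_neq0; rewrite (lt_le_trans t0)//= (le_trans xc)// ltW.
Qed.

Let F_gt0 t : 0 <= t < T -> 0 < F t.
Proof.
move=> /andP[t0 tT].
have cF : {within `[t, T], continuous F}.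
  by apply: derivable_within_continuous => x _; have [] := F_drv x.
have [c] := MVT tT (fun x _ => F_drv x) cF.
rewrite in_itv/= FT => /andP[tc cT] e.
have F1c : F1 c < 0 by apply: F1_lt0; rewrite (le_lt_trans t0)//= ltW.
have Tt : 0 < T - t by rewrite subr_gt0.
by have := pmulr_llt0 (F1 c) Tt; rewrite F1c; lra.
Qed.

Let f_gt t : 0 < t < T -> G < f t.
Proof.
move=> /andP[t0 tT].
have dfx (x : R) : x \in `]0, t[ -> is_derive x 1 f (f1 x).
  by rewrite in_itv/= => /andP[x0 xt]; apply: f_drv; rewrite ltW//= (lt_trans xt).
have cf : {within `[0, t], continuous f}.
  apply: derivable_within_continuous => x; rewrite in_itv/= => /andP[x0 xt].
  have xT : 0 <= x < T by rewrite x0 (le_lt_trans xt).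
  by have [] := f_drv xT.
have [c] := MVT t0 dfx cf.
rewrite in_itv/= f0 subr0 => /andP[c0 ct] e.
have f1c : 0 < f1 c by apply: f1_gt0; rewrite c0 (lt_trans ct).
by have := mulr_gt0 f1c t0; rewrite -e subr_gt0.
Qed.

(* u = G^2 / f runs from G to 0 on [0, T] like F, with the first-order equation
   u'^2 = (G^2 - u^2) (G^2 + u^2 + L u^2 / G^2), to be compared with F_energy. *)
Let u (t : R) : R := if t < T then G ^+ 2 / f t else 0.
Let u1 (t : R) : R := - (G ^+ 2 * f1 t / f t ^+ 2).

Let f_gt0 t : 0 <= t < T -> 0 < f t.
Proof.
move=> /andP[]; rewrite le_eqVlt => /predU1P[<- _|t0 tT]; first by rewrite f0.
by rewrite (lt_trans G_gt0)// f_gt// t0.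
Qed.

Let u_drv (t : R) : 0 <= t < T -> is_derive t 1 u (u1 t).
Proof.
move=> tT; have ft := f_drv tT.
have f0' : f t != 0 by rewrite gt_eqF// f_gt0.
apply: (@near_eq_is_derive _ _ _ (fun x => G ^+ 2 * (f x)^-1)).
  have /andP[_ tT'] := tT; near=> x; rewrite /u ifT//.
  by near: x; exact: lt_nbhsl.
by rewrite /u1; derive; field.
Unshelve. all: by end_near. Qed.

Let u_itv t : 0 < t < T -> 0 < u t < G.
Proof.
move=> tT; have := f_gt tT; have /andP[t0 tT'] := tT => fG.
have fp : 0 < f t by rewrite (lt_trans G_gt0).
rewrite /u tT' divr_gt0 ?exprn_gt0//= ltr_pdivrMr// expr2.
by rewrite ltr_pM2l.
Qed.

Let u1_lt0 t : 0 < t < T -> u1 t < 0.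
Proof.
move=> tT; have fp : 0 < f t by rewrite (lt_trans G_gt0)// f_gt.
rewrite /u1 oppr_lt0; apply: divr_gt0; last exact: exprn_gt0.
by apply: mulr_gt0; [exact: exprn_gt0|exact: f1_gt0].
Qed.

Let u_energy t : 0 < t < T ->
  u1 t ^+ 2 = (G ^+ 2 - u t ^+ 2) * (G ^+ 2 + u t ^+ 2 + L * u t ^+ 2 / G ^+ 2).
Proof.
move=> tT; have /andP[t0 tT'] := tT.
have E : f1 t ^+ 2 = (f t ^+ 2 - G ^+ 2) * (f t ^+ 2 + G ^+ 2 + L).
  by apply: f_energy; rewrite ltW.
have fp : f t != 0 by rewrite gt_eqF// (lt_trans G_gt0)// f_gt.
have Gp : G != 0 by rewrite gt_eqF.
rewrite /u1 /u tT' sqrrN expr_div_n exprMn E.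
by field; rewrite fp Gp.
Qed.

(** The value 0 assigned to [u] at [T] is the left limit of G^2 / f, by the blow-up of [f]. *)
Let cvg_u : {within `[0, T], continuous u}.
Proof.
apply/(continuous_within_itvP _ T_gt0); split.
- move=> x; rewrite in_itv/= => /andP[x0 xT].
  have xT' : 0 <= x < T by rewrite ltW.
  exact: is_derive_continuous (u_drv xT').
- have T0 : 0 <= (0 : R) < T by apply/andP.
  exact/cvg_at_right_filter/(is_derive_continuous (u_drv T0)).
- rewrite {2}/u ltxx; apply: (@cvg_trans _ (G ^+ 2 * (f t)^-1 @[t --> T^'-])).
    apply: near_eq_cvg; near=> x; rewrite /u ifT//.
  by rewrite -(mulr0 (G ^+ 2)); apply: cvgMr.
Unshelve. all: by end_near. Qed.

Let W (t : R) : R := F1 t * u t - F t * u1 t.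
Let W1 (t : R) : R :=
  - (2 * F t * u t * (F t ^+ 2 - u t ^+ 2 + L * (1 - u t ^+ 2 / G ^+ 2))).

Let W_drv (t : R) : 0 <= t < T -> is_derive t 1 W (W1 t).
Proof.
move=> tT; have ut := u_drv tT; have Ft := F_drv t; have F1t := F1_drv t.
have ft := f_drv tT; have f1t := f1_drv tT.
have f0' : f t != 0 by rewrite gt_eqF// f_gt0.
(* Second-order equation of [u]: differentiating G^2 / f twice leaves a square of [f1], which the
   first integral of [f] eliminates. *)
have u1t : is_derive t 1 u1 (L * u t - 2 * u t ^+ 3 - 2 * L * u t ^+ 3 / G ^+ 2).
  have f20 : f t ^+ 2 != 0 by rewrite expf_neq0.
  have E := f_energy tT.
  have Gp : G != 0 by rewrite gt_eqF.
  have /andP[_ tT'] := tT.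
  rewrite /u1; derive; rewrite /u tT'.
  apply: (@mulIf _ (f t ^+ 3)); first by rewrite expf_neq0.
  transitivity (2 * G ^+ 2 * f1 t ^+ 2 - G ^+ 2 * f t * (L * f t + 2 * f t ^+ 3)).
    by field.
  by rewrite E; field; rewrite f0' Gp.
by rewrite /W /W1; derive; field; rewrite gt_eqF.
Qed.

Let W0 : W 0 = 0.
Proof. by rewrite /W /u1 F10 f10; ring. Qed.

(** In each product of [W] the factor [u] or [F] will tend to 0 at [T], while [F1] and [u1] are
    bounded through the first integrals. Those bound squares, and |x| <= 1 + x^2 accounts for the
    leading 1 of the constant. *)
Let W_bound t : 0 < t < T ->
  `|W t| <= (1 + G ^+ 2 * (3 * G ^+ 2 + 2 * `|L|)) * (u t + F t).
Proof.
move=> tT; have /andP[t0 tT'] := tT.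
have G2 := exprn_gt0 2 G_gt0.
have /andP[up uG] := u_itv tT.
have Fp : 0 < F t by apply: F_gt0; rewrite ltW.
have Fl : F t ^+ 2 < G ^+ 2 by apply: F_lt; rewrite t0 ltW.
have ul : u t ^+ 2 < G ^+ 2 by rewrite ltr_pXn2r ?nnegrE// ltW.
have sq (x K : R) : x ^+ 2 <= K -> `|x| <= 1 + K.
  move=> xK; have := sqr_ge0 (`|x| - 1); rewrite sqrrB real_normK ?num_real//.
  by rewrite mulr1 expr1n mulr2n; have := normr_ge0 x; lra.
set M := 1 + _.
have L1 := ler_norm L.
have F1M : `|F1 t| <= M.
  apply: sq; rewrite F_energy.
  have := sqr_ge0 (F t); move: Fl; move: (F t ^+ 2) (G ^+ 2) `|L| L1 (normr_ge0 L) GL_gt0 => *.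
  by rewrite ler_pM//; lra.
have u1M : `|u1 t| <= M.
  apply: sq; rewrite u_energy//.
  have ug : 0 <= u t ^+ 2 / G ^+ 2 <= 1.
    by rewrite divr_ge0 ?sqr_ge0//= ler_pdivrMr// mul1r ltW.
  have Lug : L * u t ^+ 2 / G ^+ 2 <= `|L|.
    rewrite -mulrA; have := normr_ge0 L; move: ug L1; move: (u t ^+ 2 / _) `|L| => ? ? ? ? ?.
    by nra.
  rewrite (@le_trans _ _ (G ^+ 2 * (G ^+ 2 + u t ^+ 2 + L * u t ^+ 2 / G ^+ 2)))//.
    rewrite ler_wpM2r//; last by have := sqr_ge0 (u t); lra.
    have /andP[ug0 ug1] := ug.
    rewrite -mulrA.
    have := sqr_ge0 (u t); move: ug0 ug1 ul; have := GL_gt0.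
    move=> h1 h2 h3 h4 h5.
    have [L0|L0] := leP 0 L; first by have := mulr_ge0 L0 h2; lra.
    have : L <= L * (u t ^+ 2 / G ^+ 2) by nra.
    lra.
  by rewrite ler_wpM2l// ?ltW//; have := normr_ge0 L; lra.
rewrite /W (le_trans (ler_normB _ _))// !normrM mulrDr lerD//.
  by rewrite (gtr0_norm up) ler_wpM2r// ltW.
by rewrite (gtr0_norm Fp) mulrC ler_wpM2r// ltW.
Qed.

Let cvg_bound (M : R) : M * (u t + F t) @[t --> T^'-] --> 0.
Proof.
rewrite -(mulr0 M) -(addr0 0); apply: cvgMr; apply: cvgD.
  have [_ _] := (continuous_within_itvP _ T_gt0).1 cvg_u.
  by rewrite {2}/u ltxx.
rewrite -FT; apply: cvg_at_left_filter; exact: is_derive_continuous (F_drv T).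
Qed.

Let D (t : R) : R := F t - u t.

Let cD : {within `[0, T], continuous D}.
Proof.
apply: within_continuousB cvg_u.
by apply: derivable_within_continuous => x _; have [] := F_drv x.
Qed.

Let D_drv (t : R) : 0 < t < T -> is_derive t 1 D (F1 t - u1 t).
Proof.
move=> /andP[t0 tT]; have tT' : 0 <= t < T by rewrite ltW.
by have ut := u_drv tT'; have Ft := F_drv t; rewrite /D; derive.
Qed.

Let D0 : D 0 = 0.
Proof. by rewrite /D /u T_gt0 F0 f0; field; rewrite gt_eqF. Qed.

Let DT : D T = 0.
Proof. by rewrite /D /u ltxx FT subrr. Qed.

(* If L > 0 then F > u on (0, T), since F falls more steeply than u wherever
   F <= u; but then the Wronskian W has a constant sign derivative while it
   vanishes at both ends. The case L < 0 is symmetric. *)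
Theorem quarter_period_self_dual : L = 0.
Proof.
have G2 := exprn_gt0 2 G_gt0.
have sqr_lt (a b : R) : a < 0 -> b < 0 -> a ^+ 2 < b ^+ 2 -> b < a.
  by move=> a0 b0 h; rewrite ltNge; apply/negP => ab; nra.
have eqn (a b : R) : 0 < a -> 0 < b -> a <= b -> a ^+ 2 <= b ^+ 2.
  by move=> a0 b0 ab; rewrite ler_pXn2r// nnegrE ltW.
have [L0|L0|//] := ltgtP L 0; exfalso.
- have Dlt (t : R) : 0 < t < T -> 0 < - D t.
    apply: (@pos_of_neg_slope _ T (fun t => - D t) (fun t => - (F1 t - u1 t))) => //.
    - move=> x; apply: cvgN; exact: cD.
    - by rewrite D0 oppr0.
    - by rewrite DT oppr0.
    - by move=> x xT; have Dx := D_drv xT; derive.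
    move=> x xT; rewrite oppr_le0 oppr_lt0 /D subr_ge0 subr_gt0 => uF.
    have /andP[x0 xT'] := xT; have /andP[up uG] := u_itv xT.
    have Fp : 0 < F x by apply: F_gt0; rewrite ltW.
    have Fl : F x ^+ 2 < G ^+ 2 by apply: F_lt; rewrite x0 ltW.
    apply: sqr_lt; rewrite ?u1_lt0 ?F1_lt0 ?x0 ?ltW//.
    rewrite F_energy u_energy//.
    have := eqn _ _ up Fp uF; have := exprn_gt0 2 up.
    have := GL_gt0; move: Fl G2.
    move: (F x ^+ 2) (u x ^+ 2) (G ^+ 2) => a b g ag g0 gL b0 ba.
    (* Difference of the squared slopes of [u] and [F] at one time, with a = F^2, b = u^2, g = G^2.
       The term in (g - a)^2 is the gap at equal height; the other one is nonnegative because b <= a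
       and g + L > 0. *)
    have e : (g - b) * (g + b + L * b / g) - (g - a) * (g + a + L) =
      ((a - b) * (- L * g + (g + L) * (a + b)) + - L * (g - a) ^+ 2) / g.
      by field; rewrite gt_eqF.
    rewrite -subr_gt0 e divr_gt0//.
    have h1 : 0 < - L * (g - a) ^+ 2 by rewrite mulr_gt0 ?exprn_gt0//; lra.
    have h2 : 0 <= (a - b) * (- L * g + (g + L) * (a + b)).
      rewrite mulr_ge0//; first by lra.
      by rewrite addr_ge0// mulr_ge0//; lra.
    lra.
  apply: (@increasing_not_vanishing _ T W W1
    (fun t => (1 + G ^+ 2 * (3 * G ^+ 2 + 2 * `|L|)) * (u t + F t))) => //.
  + move=> t tT; rewrite /W1 oppr_gt0 -mulrA.
    have /andP[t0 tT'] := tT; have /andP[up uG] := u_itv tT.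
    have Fp : 0 < F t by apply: F_gt0; rewrite ltW.
    rewrite pmulr_rlt0 ?mulr_gt0// pmulr_rlt0//.
    have := Dlt t tT; rewrite /D opprB subr_gt0 => Fu.
    have h1 : F t ^+ 2 < u t ^+ 2 by rewrite ltr_pXn2r// nnegrE ltW.
    have h2 : u t ^+ 2 / G ^+ 2 < 1.
      by rewrite ltr_pdivrMr// mul1r ltr_pXn2r// nnegrE ltW.
    have : L * (1 - u t ^+ 2 / G ^+ 2) < 0 by rewrite nmulr_rlt0// subr_gt0.
    lra.
  + by move=> t tT; rewrite (le_trans (ler_norm _))// W_bound.
- have Dgt (t : R) : 0 < t < T -> 0 < D t.
    apply: (@pos_of_neg_slope _ T D (fun t => F1 t - u1 t)) => //.
    move=> x xT; rewrite /D subr_le0 subr_lt0 => Fu.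
    have /andP[x0 xT'] := xT; have /andP[up uG] := u_itv xT.
    have Fp : 0 < F x by apply: F_gt0; rewrite ltW.
    have ul : u x ^+ 2 < G ^+ 2 by rewrite ltr_pXn2r ?nnegrE// ltW.
    apply: sqr_lt; rewrite ?u1_lt0 ?F1_lt0 ?x0 ?ltW//.
    rewrite F_energy u_energy//.
    have := eqn _ _ Fp up Fu; have := exprn_gt0 2 Fp.
    move: ul G2.
    move: (F x ^+ 2) (u x ^+ 2) (G ^+ 2) => a b g bg g0 a0 ab.
    have e : (g - a) * (g + a + L) - (g - b) * (g + b + L * b / g) =
      (b - a) * (a + b + L) + L * (g - b) ^+ 2 / g.
      by field; rewrite gt_eqF.
    rewrite -subr_gt0 e ltr_wpDl// ?mulr_ge0//; [lra|lra|].
    by rewrite divr_gt0// mulr_gt0// exprn_gt0// subr_gt0.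
  apply: (@increasing_not_vanishing _ T (fun t => - W t) (fun t => - W1 t)
    (fun t => (1 + G ^+ 2 * (3 * G ^+ 2 + 2 * `|L|)) * (u t + F t))) => //.
  + by rewrite W0 oppr0.
  + by move=> t tT; have Wt := W_drv tT; derive.
  + move=> t tT; rewrite /W1 opprK.
    have /andP[t0 tT'] := tT; have /andP[up uG] := u_itv tT.
    have Fp : 0 < F t by apply: F_gt0; rewrite ltW.
    have := Dgt t tT; rewrite /D subr_gt0 => Fu.
    have h1 : u t ^+ 2 < F t ^+ 2 by rewrite ltr_pXn2r// nnegrE ltW.
    have h2 : u t ^+ 2 / G ^+ 2 < 1.
      by rewrite ltr_pdivrMr// mul1r ltr_pXn2r// nnegrE ltW.
    rewrite !mulr_gt0// addr_gt0 ?subr_gt0//.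
    by rewrite mulr_gt0// subr_gt0.
  + by move=> t tT; rewrite (le_trans (ler_norm _))// normrN W_bound.
Qed.

End quarter_period.

(** * Signed sums of absolutely summable families *)

Section nonnegative_sums.
Context {R : realType} {T : choiceType}.
Implicit Types u v : T -> R.

Definition abs_summable u := (\esum_(i in [set: T]) `|u i|%:E < +oo)%E.

(** Since [fine] sends [+oo] to 0, the value is meaningful only for summable families. *)
Definition nsum u : R := fine (\esum_(i in [set: T]) (u i)%:E)%E.

Lemma esumZl (c : R) u : 0 <= c -> (forall i, 0 <= u i) ->
  (\esum_(i in [set: T]) (c * u i)%:E =
   c%:E * \esum_(i in [set: T]) (u i)%:E)%E.
Proof.
have ub (d : R) v : 0 <= d -> (forall i, 0 <= v i) ->
    (\esum_(i in [set: T]) (d * v i)%:E <=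
     d%:E * \esum_(i in [set: T]) (v i)%:E)%E.
  move=> d0 v0; apply: ge_ereal_sup => _ [A AS <-].
  under eq_fsbigr do rewrite EFinM.
  rewrite -ge0_mule_fsumr; last by move=> i; rewrite lee_fin.
  rewrite lee_wpmul2l ?lee_fin//.
  by apply: esum_ge; exists A.
move=> c0 u0; apply/eqP; rewrite eq_le ub//=.
have /predU1P[<-|{}c0] : (0 == c) || (0 < c) by rewrite -le_eqVlt.
  by rewrite mul0e esum_ge0// => i _; rewrite mul0r.
rewrite muleC -lee_pdivlMr//.
have cu0 i : 0 <= c * u i by rewrite mulr_ge0// ltW.
have := @ub c^-1 (fun i => c * u i).
rewrite invr_ge0 (ltW c0) => /(_ isT cu0).
by under eq_esum do rewrite mulKf ?gt_eqF//; rewrite muleC.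
Qed.

Lemma nsumK u : (forall i, 0 <= u i) -> abs_summable u ->
  ((nsum u)%:E = \esum_(i in [set: T]) (u i)%:E)%E.
Proof.
move=> u0 us; rewrite /nsum fineK// ge0_fin_numE; last first.
  by apply: esum_ge0 => i _; rewrite lee_fin.
by move: us; rewrite /abs_summable; under eq_esum do rewrite ger0_norm//.
Qed.

Lemma le_abs_summable u v : (forall i, `|u i| <= `|v i|) ->
  abs_summable v -> abs_summable u.
Proof.
move=> uv; apply: le_lt_trans; apply: le_esum => i _.
by rewrite lee_fin.
Qed.

Lemma abs_summableZ (c : R) u : abs_summable u -> abs_summable (fun i => c * u i).
Proof.
rewrite /abs_summable => us; under eq_esum do rewrite normrM.
rewrite esumZl// lte_mul_pinfty ?lee_fin//.
Qed.

Lemma abs_summableD u v : abs_summable u -> abs_summable v ->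
  abs_summable (fun i => u i + v i).
Proof.
rewrite /abs_summable => us vs.
apply: (@le_lt_trans _ _ (\esum_(i in [set: T]) (`|u i|%:E + `|v i|%:E)%E)).
  by apply: le_esum => i _; rewrite -EFinD lee_fin ler_normD.
by rewrite esumD ?lte_add_pinfty// => i _; rewrite lee_fin.
Qed.

Lemma abs_summableN u : abs_summable u -> abs_summable (fun i => - u i).
Proof. by apply: le_abs_summable => i; rewrite normrN. Qed.

Lemma abs_summableB u v : abs_summable u -> abs_summable v ->
  abs_summable (fun i => u i - v i).
Proof. by move=> us vs; apply: abs_summableD => //; exact: abs_summableN. Qed.

Lemma abs_summable_norm u : abs_summable u -> abs_summable (fun i => `|u i|).
Proof. by apply: le_abs_summable => i; rewrite normr_id. Qed.

Lemma nsum_ge0 u : (forall i, 0 <= u i) -> 0 <= nsum u.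
Proof. by move=> u0; rewrite fine_ge0// esum_ge0// => i _; rewrite lee_fin. Qed.

Lemma nsumD u v : (forall i, 0 <= u i) -> (forall i, 0 <= v i) ->
  abs_summable u -> abs_summable v ->
  nsum (fun i => u i + v i) = nsum u + nsum v.
Proof.
move=> u0 v0 us vs; apply: EFin_inj.
rewrite EFinD !nsumK//; last 2 first.
- by move=> i; rewrite addr_ge0.
- exact: abs_summableD.
by rewrite -esumD// => i _; rewrite lee_fin.
Qed.

End nonnegative_sums.

Section signed_sums.
Context {R : realType} {T : choiceType}.
Implicit Types u v : T -> R.

Definition pos_part u i := Num.max (u i) 0.
Definition neg_part u i := Num.max (- u i) 0.

(** An unordered sum: no enumeration of the index type enters, so reindexing along any bijection and
    exchanging two sums reduce to the nonnegative case. *)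
Definition psum u : R := nsum (pos_part u) - nsum (neg_part u).

Lemma pos_part_ge0 u i : 0 <= pos_part u i.
Proof. by rewrite le_max lexx orbT. Qed.

Lemma neg_part_ge0 u i : 0 <= neg_part u i.
Proof. by rewrite le_max lexx orbT. Qed.

Lemma pos_neg_part u i : u i = pos_part u i - neg_part u i.
Proof. by rewrite /pos_part /neg_part; case: leP => ?; case: leP => ?; lra. Qed.

Lemma norm_pos_neg_part u i : `|u i| = pos_part u i + neg_part u i.
Proof.
rewrite /pos_part /neg_part; case: leP => h1; case: leP => h2.
- have -> : u i = 0 by lra.
  by rewrite normr0; lra.
- by rewrite ler0_norm//; lra.
- by rewrite gtr0_norm//; lra.
- by lra.
Qed.

Lemma pos_part_summable u : abs_summable u -> abs_summable (pos_part u).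
Proof.
apply: le_abs_summable => i; rewrite (norm_pos_neg_part u) ger0_norm ?pos_part_ge0//.
by rewrite lerDl neg_part_ge0.
Qed.

Lemma neg_part_summable u : abs_summable u -> abs_summable (neg_part u).
Proof.
apply: le_abs_summable => i; rewrite (norm_pos_neg_part u) ger0_norm ?neg_part_ge0//.
by rewrite lerDr pos_part_ge0.
Qed.

(** Any splitting into nonnegative summable families may replace the canonical one: from w = u - v =
    w+ - w- follows w+ + v = u + w-, an identity between nonnegative families to which additivity
    applies. Linearity of [psum] rests on this. *)
Lemma psum_sub u v : (forall i, 0 <= u i) -> (forall i, 0 <= v i) ->
  abs_summable u -> abs_summable v ->
  psum (fun i => u i - v i) = nsum u - nsum v.
Proof.
move=> u0 v0 us vs; set w := fun i => _.
have ws : abs_summable w by exact: abs_summableB.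
have : nsum (fun i => pos_part w i + v i) = nsum (fun i => u i + neg_part w i).
  congr nsum; apply/funext => i.
  by have := pos_neg_part w i; rewrite {1}/w; lra.
have p0 := pos_part_ge0 w; have n0 := neg_part_ge0 w.
have ps := pos_part_summable ws; have ns := neg_part_summable ws.
by rewrite !nsumD// /psum; lra.
Qed.

Lemma psum_nsum u : (forall i, 0 <= u i) -> abs_summable u -> psum u = nsum u.
Proof.
move=> u0 us; have z (i : T) : (0 : R) <= 0 by [].
have zs : abs_summable (fun _ : T => 0 : R).
  apply: (le_abs_summable _ us) => i.
  by rewrite normr0.
have := psum_sub u0 z us zs.
have -> : (fun i => u i - 0) = u by apply/funext => i; rewrite subr0.
move=> ->; rewrite /nsum [X in _ - X](_ : _ = 0) ?subr0//.
by rewrite esum1.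
Qed.

Lemma psumK u : (forall i, 0 <= u i) -> abs_summable u ->
  ((psum u)%:E = \esum_(i in [set: T]) (u i)%:E)%E.
Proof. by move=> u0 us; rewrite psum_nsum// nsumK. Qed.

Lemma eq_psum u v : u =1 v -> psum u = psum v.
Proof. by move=> /funext ->. Qed.

Lemma psumD u v : abs_summable u -> abs_summable v ->
  psum (fun i => u i + v i) = psum u + psum v.
Proof.
move=> us vs.
have -> : (fun i => u i + v i) =
    (fun i => (pos_part u i + pos_part v i) - (neg_part u i + neg_part v i)).
  apply/funext => i; rewrite (pos_neg_part u) (pos_neg_part v); ring.
have pu := pos_part_ge0 u; have nu := neg_part_ge0 u.
have pv := pos_part_ge0 v; have nv := neg_part_ge0 v.
have psu := pos_part_summable us; have nsu := neg_part_summable us.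
have psv := pos_part_summable vs; have nsv := neg_part_summable vs.
rewrite psum_sub.
- by rewrite !nsumD// /psum; ring.
- by move=> i; rewrite addr_ge0.
- by move=> i; rewrite addr_ge0.
- exact: abs_summableD.
- exact: abs_summableD.
Qed.

Lemma psumN u : abs_summable u -> psum (fun i => - u i) = - psum u.
Proof.
move=> us.
have -> : (fun i => - u i) = (fun i => neg_part u i - pos_part u i).
  apply/funext => i; rewrite {1}(pos_neg_part u); ring.
have pu := pos_part_ge0 u; have nu := neg_part_ge0 u.
have psu := pos_part_summable us; have nsu := neg_part_summable us.
by rewrite psum_sub// opprB.
Qed.

Lemma psumB u v : abs_summable u -> abs_summable v ->
  psum (fun i => u i - v i) = psum u - psum v.
Proof.
by move=> us vs; rewrite psumD ?psumN//; exact: abs_summableN.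
Qed.

Lemma psumZ (c : R) u : abs_summable u ->
  psum (fun i => c * u i) = c * psum u.
Proof.
move=> us.
have pu := pos_part_ge0 u; have nu := neg_part_ge0 u.
have psu := pos_part_summable us; have nsu := neg_part_summable us.
have nsumZ d v : 0 <= d -> (forall i, 0 <= v i) -> abs_summable v ->
    nsum (fun i => d * v i) = d * nsum v.
  move=> d0 v0 vs; apply: EFin_inj.
  rewrite EFinM !nsumK ?esumZl//; first by move=> i; rewrite mulr_ge0.
  exact: abs_summableZ.
have pZ d : 0 <= d -> psum (fun i => d * u i) = d * psum u.
  move=> d0.
  have -> : (fun i => d * u i) = (fun i => d * pos_part u i - d * neg_part u i).
    by apply/funext => i; rewrite {1}(pos_neg_part u); ring.
  rewrite psum_sub; first by rewrite !nsumZ// /psum; ring.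
  - by move=> i; rewrite mulr_ge0.
  - by move=> i; rewrite mulr_ge0.
  - exact: abs_summableZ.
  - exact: abs_summableZ.
have [c0|c0] := leP 0 c; first exact: pZ.
have -> : (fun i => c * u i) = (fun i => - (- c * u i)).
  by apply/funext => i; ring.
rewrite psumN ?pZ ?oppr_ge0 ?ltW//; first by ring.
exact: abs_summableZ.
Qed.

Lemma psum_ge0 u : (forall i, 0 <= u i) -> abs_summable u -> 0 <= psum u.
Proof. by move=> u0 us; rewrite psum_nsum// nsum_ge0. Qed.

Lemma le_psum u v : abs_summable u -> abs_summable v ->
  (forall i, u i <= v i) -> psum u <= psum v.
Proof.
move=> us vs uv; rewrite -subr_ge0 -psumB// psum_ge0//.
  by move=> i; rewrite subr_ge0.
exact: abs_summableB.
Qed.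

Lemma ler_norm_psum u v : abs_summable v -> (forall i, `|u i| <= v i) ->
  `|psum u| <= psum v.
Proof.
move=> vs uv.
have us : abs_summable u.
  by apply: (le_abs_summable _ vs) => i; rewrite (le_trans (uv i)) ?ler_norm.
rewrite ler_norml -psumN// !le_psum//.
- by move=> i; rewrite (le_trans (ler_norm _)).
- exact: abs_summableN.
- by move=> i; rewrite lerNl (le_trans _ (uv i))// -normrN ler_norm.
Qed.

Lemma psum_single (a : T) (c : R) :
  abs_summable (fun i => if i == a then c else 0) /\
  psum (fun i => if i == a then c else 0) = c.
Proof.
have H (d : R) : 0 <= d ->
    (\esum_(i in [set: T]) (if i == a then d else 0)%:E = d%:E)%E.
  move=> d0; rewrite -[RHS](@esum_set1 _ _ a (fun=> d%:E)) ?lee_fin//.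
  rewrite [RHS]esum_mkcond; apply: eq_esum => i _.
  have -> : (i \in [set a]) = (i == a) by apply/idP/eqP; rewrite inE.
  by case: ifP.
have s (d : R) : abs_summable (fun i => if i == a then d else 0).
  rewrite /abs_summable; under eq_esum do rewrite (fun_if Num.norm) normr0.
  by rewrite H// ltry.
split=> //.
have P (d : R) : 0 <= d -> psum (fun i => if i == a then d else 0) = d.
  by move=> d0; apply: EFin_inj; rewrite psumK// ?H// => i; case: ifP.
have [c0|c0] := leP 0 c; first exact: P.
have -> : (fun i => if i == a then c else 0) = (fun i => - (if i == a then - c else 0)).
  by apply/funext => i; case: ifP; rewrite ?opprK ?oppr0.
by rewrite psumN// P ?opprK// oppr_ge0 ltW.
Qed.

Lemma psum_gt0 u a : (forall i, 0 <= u i) -> abs_summable u -> 0 < u a -> 0 < psum u.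
Proof.
move=> u0 us ua; have [s p] := psum_single a (u a).
rewrite (lt_le_trans ua)// -[leLHS]p le_psum// => i.
by case: eqP => [->|].
Qed.

Lemma abs_summable_reindex (e : T -> T) u : bijective e ->
  abs_summable u -> abs_summable (u \o e).
Proof.
move=> be; rewrite /abs_summable.
by rewrite (@reindex_esum _ _ _ [set: T] [set: T] e)//; rewrite setTT_bijective.
Qed.

Lemma psum_reindex (e : T -> T) u : bijective e -> psum u = psum (u \o e).
Proof.
move=> be; have nsumE v : nsum v = nsum (v \o e).
  rewrite /nsum (@reindex_esum _ _ _ [set: T] [set: T] e)//.
  by rewrite setTT_bijective.
by rewrite /psum (nsumE (pos_part u)) (nsumE (neg_part u)).
Qed.

End signed_sums.

(** * Exchange of sums and convolution products over the integers *)

Section exchange.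
Context {R : realType} {T1 T2 : choiceType}.

Lemma esum_exchange (a : T1 -> T2 -> \bar R) : (forall i j, 0 <= a i j)%E ->
  (\esum_(i in [set: T1]) \esum_(j in [set: T2]) a i j =
   \esum_(j in [set: T2]) \esum_(i in [set: T1]) a i j)%E.
Proof.
move=> a0; rewrite !esum_esum//.
rewrite (@reindex_esum _ _ _ ([set: T2] `*`` fun=> [set: T1])
  ([set: T1] `*`` fun=> [set: T2]) (fun k => (k.2, k.1)))//.
split => //=.
- by move=> [x y] [x' y'] _ _ /= [-> ->].
- by move=> [x y] _; exists (y, x).
Qed.

Variable h : T1 -> T2 -> R.
Hypothesis hs :
  (\esum_(i in [set: T1]) \esum_(j in [set: T2]) `|h i j|%:E < +oo)%E.

Lemma row_summable i : abs_summable (h i).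
Proof.
apply: le_lt_trans hs; apply: esum_ge; exists [set i].
  by split => //; exact: finite_set1.
by rewrite fsbig_set1.
Qed.

Lemma row_nsum_summable : abs_summable (fun i => nsum (fun j => `|h i j|)).
Proof.
apply: le_lt_trans hs; apply: le_esum => i _.
rewrite ger0_norm ?nsum_ge0// nsumK//.
exact/abs_summable_norm/row_summable.
Qed.

Lemma row_psum_summable : abs_summable (fun i => psum (h i)).
Proof.
apply: (le_abs_summable _ row_nsum_summable) => i.
have s := abs_summable_norm (row_summable i).
rewrite [leRHS]ger0_norm ?nsum_ge0// -psum_nsum//.
by apply: ler_norm_psum.
Qed.

End exchange.

(** Fubini by way of Tonelli: the nonnegative exchange is applied to the positive and the negative
    part of [h], both dominated by its absolute value. *)
Lemma psum_exchange {R : realType} {T1 T2 : choiceType} (h : T1 -> T2 -> R) :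
  (\esum_(i in [set: T1]) \esum_(j in [set: T2]) `|h i j|%:E < +oo)%E ->
  psum (fun i => psum (h i)) = psum (fun j => psum (h^~ j)).
Proof.
move=> hs.
have hs' : (\esum_(j in [set: T2]) \esum_(i in [set: T1]) `|h i j|%:E < +oo)%E.
  by rewrite -esum_exchange// => i j; rewrite lee_fin.
have half (p : (T1 -> T2 -> R)) : (forall i j, 0 <= p i j) ->
    (forall i j, p i j <= `|h i j|) ->
    [/\ abs_summable (fun i => nsum (p i)), abs_summable (fun j => nsum (p^~ j)) &
    nsum (fun i => nsum (p i)) = nsum (fun j => nsum (p^~ j))].
  move=> p0 ph.
  have ps : (\esum_(i in [set: T1]) \esum_(j in [set: T2]) `|p i j|%:E < +oo)%E.
    apply: le_lt_trans hs; apply: le_esum => i _; apply: le_esum => j _.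
    by rewrite lee_fin ger0_norm.
  have ps' : (\esum_(j in [set: T2]) \esum_(i in [set: T1]) `|p i j|%:E < +oo)%E.
    by rewrite -esum_exchange// => i j; rewrite lee_fin.
  have r i : abs_summable (p i) := row_summable ps i.
  have r' j : abs_summable (p^~ j) := @row_summable _ _ _ (fun j i => p i j) ps' j.
  have s1 : abs_summable (fun i => nsum (p i)).
    rewrite (_ : (fun i => _) = (fun i => psum (p i))).
      exact: row_psum_summable.
    by apply/funext => i; rewrite psum_nsum.
  have s2 : abs_summable (fun j => nsum (p^~ j)).
    rewrite (_ : (fun i => _) = (fun j => psum (p^~ j))).
      exact: (@row_psum_summable _ _ _ (fun j i => p i j)).
    by apply/funext => i; rewrite psum_nsum.
  split => //; apply: EFin_inj.
  rewrite !nsumK//; [|by move=> j; exact: nsum_ge0..].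
  under eq_esum => i _ do rewrite nsumK//.
  under [RHS]eq_esum => j _ do rewrite nsumK//.
  by rewrite esum_exchange// => i j; rewrite lee_fin.
have [||pa pb pc] := half (fun i j => pos_part (h i) j).
- by move=> i j; exact: pos_part_ge0.
- by move=> i j; rewrite norm_pos_neg_part lerDl neg_part_ge0.
have [||na nb nc] := half (fun i j => neg_part (h i) j).
- by move=> i j; exact: neg_part_ge0.
- by move=> i j; rewrite norm_pos_neg_part lerDr pos_part_ge0.
rewrite [LHS]psum_sub//; [|by move=> i; exact: nsum_ge0 (pos_part_ge0 _)|
  by move=> i; exact: nsum_ge0 (neg_part_ge0 _)].
rewrite [RHS]psum_sub//; [|by move=> i; exact: nsum_ge0 (pos_part_ge0 _)|
  by move=> i; exact: nsum_ge0 (neg_part_ge0 _)].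
by congr (_ - _).
Qed.

Section convolution.
Context {R : realType}.
Implicit Types u v : int -> R.

Lemma shift_bij (a : int) : bijective (fun n : int => n - a).
Proof. by exists (fun n => n + a) => n; ring. Qed.

Lemma refl_bij (a : int) : bijective (fun n : int => a - n).
Proof. by exists (fun n => a - n) => n; ring. Qed.

Lemma conv_esum_lty u v : abs_summable u -> abs_summable v ->
  (\esum_(m in [set: int]) \esum_(n in [set: int]) `|u m * v (n - m)|%:E < +oo)%E.
Proof.
move=> us vs.
have e (m : int) : (\esum_(n in [set: int]) `|u m * v (n - m)%R|%:E =
    `|u m * nsum (fun n => `|v n|)|%:E)%E.
  under eq_esum do rewrite normrM.
  rewrite (esumZl _ (u := fun n => `|v (n - m)|))// normrM EFinM.
  congr (_ * _)%E; rewrite ger0_norm ?nsum_ge0// nsumK//; last exact: abs_summable_norm.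
  by rewrite [RHS](@reindex_esum _ _ _ [set: int] [set: int] (fun n => n - m))//
    setTT_bijective; exact: shift_bij.
under eq_esum do rewrite e.
have := abs_summableZ (nsum (fun n => `|v n|)) us.
by rewrite /abs_summable; under eq_esum do rewrite mulrC.
Qed.

Lemma psum_mul u v : abs_summable u -> abs_summable v ->
  psum u * psum v = psum (fun n => psum (fun m => u m * v (n - m))).
Proof.
move=> us vs; rewrite -(psum_exchange (conv_esum_lty us vs)).
rewrite mulrC -psumZ//; apply: eq_psum => m.
rewrite mulrC (psum_reindex _ (shift_bij m)) psumZ//.
exact: abs_summable_reindex (shift_bij m) vs.
Qed.

Lemma conv_esum_swap_lty u v : abs_summable u -> abs_summable v ->
  (\esum_(n in [set: int]) \esum_(m in [set: int]) `|u m * v (n - m)|%:E < +oo)%E.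
Proof.
move=> us vs; rewrite -esum_exchange; first exact: conv_esum_lty.
by move=> i j; rewrite lee_fin.
Qed.

Lemma conv_summable u v : abs_summable u -> abs_summable v ->
  abs_summable (fun n => psum (fun m => u m * v (n - m))).
Proof.
move=> us vs; apply: (@row_psum_summable _ _ _ (fun n m => u m * v (n - m))).
exact: conv_esum_swap_lty.
Qed.

Lemma conv_row_summable u v n : abs_summable u -> abs_summable v ->
  abs_summable (fun m => u m * v (n - m)).
Proof.
move=> us vs; apply: (@row_summable _ _ _ (fun n m => u m * v (n - m))).
exact: conv_esum_swap_lty.
Qed.

End convolution.

(** A remainder of order h^2 in every term, with summable constants [M], sums to a remainder of
    order h^2; divided by h it tends to 0. *)
Lemma is_derive_psum {R : realType} {T : choiceType} (g g1 : R -> T -> R)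
    (M : T -> R) (x rho : R) : 0 < rho -> abs_summable M ->
  (forall y, `|y - x| < rho -> abs_summable (g y)) -> abs_summable (g1 x) ->
  (forall i h, `|h| < rho ->
     `|g (x + h) i - g x i - h * g1 x i| <= M i * h ^+ 2) ->
  is_derive x 1 (fun y => psum (g y)) (psum (g1 x)).
Proof.
move=> rho0 Ms gs g1s gM.
have gxs : abs_summable (g x) by apply: gs; rewrite subrr normr0.
have bound (h : R) : `|h| < rho ->
    `|psum (g (x + h)) - psum (g x) - h * psum (g1 x)| <= psum M * h ^+ 2.
  move=> hrho; have s : abs_summable (g (x + h)) by apply: gs; rewrite addrAC subrr add0r.
  rewrite -psumZ// -!psumB//; last 2 first.
  - exact: abs_summableB.
  - exact: abs_summableZ.
  rewrite mulrC -psumZ//; apply: ler_norm_psum; first exact: abs_summableZ.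
  by move=> i; rewrite (mulrC (h ^+ 2)); exact: gM.
pose K := 1 + `|psum M|.
have K0 : 0 < K by rewrite /K; have := normr_ge0 (psum M); lra.
have lim : h^-1 *: (psum (g (h *: 1 + x)) - psum (g x)) @[h --> 0^'] --> psum (g1 x).
  apply/cvgrPdist_le => e e0; near=> h.
  have h0 : h != 0 by near: h; exact: nbhs_dnbhs_neq.
  have hrho : `|h| < rho by near: h; apply: dnbhs0_lt.
  rewrite -(@ler_pM2l _ `|h|) ?normr_gt0// -normrM.
  have -> : h * (psum (g1 x) - h^-1 *: (psum (g (h *: 1 + x)) - psum (g x))) =
    - (psum (g (x + h)) - psum (g x) - h * psum (g1 x)).
    have -> : h *: 1 + x = x + h by rewrite addrC; congr (_ + _); exact: mulr1.
    rewrite -[_ *: _]/(_ * _) mulrBr mulrA divff// mul1r.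
    ring.
  rewrite normrN (le_trans (bound h hrho))//.
  have -> : h ^+ 2 = `|h| * `|h| by rewrite -expr2 real_normK ?num_real.
  rewrite mulrCA ler_wpM2l//.
  rewrite (@le_trans _ _ (K * `|h|))//.
    by rewrite ler_wpM2r// /K; have := ler_norm (psum M); lra.
  rewrite mulrC -ler_pdivlMr//; near: h.
  by apply: (@dnbhs0_le R R (e / K)); exact: divr_gt0.
have dg : derivable (fun y => psum (g y)) x 1 by apply/cvg_ex; exists (psum (g1 x)).
by split => //; apply/cvg_lim.
Unshelve. all: by end_near. Qed.

Lemma geometric_summable {R : realType} (r : R) : 0 <= r < 1 ->
  abs_summable (fun k : int => r ^+ absz k).
Proof.
move=> /andP[r0 r1].
have nn : (\esum_(n in [set: nat]) (r ^+ n)%:E < +oo)%E.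
  rewrite -nneseries_esumT; last by move=> n; rewrite lee_fin exprn_ge0.
  rewrite (@le_lt_trans _ _ (1 / (1 - r))%:E) ?ltry//.
  apply: lime_le; first by apply: is_cvg_nneseries => n _ _; rewrite lee_fin exprn_ge0.
  near=> n; rewrite sumEFin lee_fin.
  have := geometric_seriesE 1 (negbT (lt_eqF r1)) => /(congr1 (fun f => f n)).
  rewrite /series /geometric /=; under eq_bigr do rewrite mul1r.
  move=> ->; rewrite mul1r ler_pM2r ?invr_gt0 ?subr_gt0//.
  by rewrite gerBl exprn_ge0.
rewrite /abs_summable; under eq_esum do rewrite ger0_norm ?exprn_ge0//.
rewrite (esumID (range Posz)); last by move=> i _; rewrite lee_fin exprn_ge0.
rewrite !setTI.
have -> : ~` range Posz = range Negz.
  apply/seteqP; split => [[n|n] /=|_ [n _ <-] [m _]//].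
  - by move=> H; exfalso; apply: H; exists n.
  - by move=> _; exists n.
have bP : set_bij [set: nat] (range Posz) Posz by split => // x y _ _ [].
have bN : set_bij [set: nat] (range Negz) Negz by split => // x y _ _ [].
rewrite (reindex_esum _ _ _ _ bP) (reindex_esum _ _ _ _ bN).
rewrite lte_add_pinfty//.
apply: le_lt_trans nn; apply: le_esum => i _.
by rewrite lee_fin exprS ler_piMl ?exprn_ge0// ltW.
Unshelve. all: by end_near. Qed.

(** * Convolutions of the hyperbolic secant sequence *)

Section hyperbolic.
Context {R : realType}.
Implicit Types x y : R.

Definition sinh x : R := (expR x - expR (- x)) / 2.
Definition tanh x : R := sinh x * sech x.

Lemma cosh_gt0 x : 0 < cosh x.
Proof. by rewrite /cosh divr_gt0// addr_gt0 ?expR_gt0. Qed.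

Lemma cosh_neq0 x : cosh x != 0.
Proof. by rewrite gt_eqF ?cosh_gt0. Qed.

Lemma sech_gt0 x : 0 < sech x.
Proof. by rewrite /sech invr_gt0 cosh_gt0. Qed.

Lemma sinh0 : sinh 0 = 0.
Proof. by rewrite /sinh oppr0 subrr mul0r. Qed.

Lemma coshN x : cosh (- x) = cosh x.
Proof. by rewrite /cosh opprK addrC. Qed.

Lemma sechN x : sech (- x) = sech x.
Proof. by rewrite /sech coshN. Qed.

Lemma sinhN x : sinh (- x) = - sinh x.
Proof. by rewrite /sinh opprK -mulNr opprB. Qed.

Lemma tanhN x : tanh (- x) = - tanh x.
Proof. by rewrite /tanh sinhN sechN mulNr. Qed.

Lemma coshD x y : cosh (x + y) = cosh x * cosh y + sinh x * sinh y.
Proof. by rewrite /cosh /sinh opprD !expRD; field. Qed.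

Lemma sinhD x y : sinh (x + y) = sinh x * cosh y + cosh x * sinh y.
Proof. by rewrite /cosh /sinh opprD !expRD; field. Qed.

(** Source of the telescoping: in a convolution the sum of the two arguments is fixed, so the sinh
    is a common factor and each product of secants splits into two separate tangents. *)
Lemma sech_tanhD x y : sech x * sech y * sinh (x + y) = tanh x + tanh y.
Proof.
by rewrite sinhD /tanh /sech; field; rewrite !cosh_neq0.
Qed.

Lemma sech_tanhB x y : tanh x - tanh y = sinh (x - y) * (sech x * sech y).
Proof. by rewrite -tanhN -sech_tanhD sechN mulrC. Qed.

Lemma cosh_sech x y : sech y * cosh (x + y) = cosh x + sinh x * tanh y.
Proof. by rewrite coshD /tanh /sech; field; rewrite cosh_neq0. Qed.

Lemma sech_le x : sech x <= 2 * expR (- `|x|).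
Proof.
wlog x0 : x / 0 <= x => [H|].
  have [/H//|x0] := leP 0 x; rewrite -sechN -normrN; apply: H.
  by rewrite oppr_ge0 ltW.
rewrite ger0_norm// /sech /cosh invf_div ler_pM2l// expRN lef_pV2 ?posrE ?expR_gt0//.
  by rewrite lerDl invr_ge0 expR_ge0.
by rewrite addr_gt0 ?invr_gt0 ?expR_gt0.
Qed.

Lemma sech_le1 x : sech x <= 1.
Proof.
rewrite /sech invf_le1 ?cosh_gt0// /cosh expRN ler_pdivlMr// mul1r.
have e0 := expR_gt0 x; have := sqr_ge0 (expR x - 1).
have -> : expR x + (expR x)^-1 = (expR x ^+ 2 + 1) / expR x.
  by field; rewrite gt_eqF.
by rewrite ler_pdivlMr//; lra.
Qed.

Lemma sech_lower x : expR (- `|x|) <= sech x.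
Proof.
wlog x0 : x / 0 <= x => [H|].
  have [/H//|x0] := leP 0 x; rewrite -sechN -normrN; apply: H.
  by rewrite oppr_ge0 ltW.
rewrite ger0_norm// /sech /cosh expRN lef_pV2 ?posrE ?expR_gt0 ?divr_gt0
  ?addr_gt0 ?expR_gt0 ?invr_gt0 ?expR_gt0//.
rewrite ler_pdivrMr//.
have : (expR x)^-1 <= expR x.
  by rewrite -expRN ler_expR; lra.
by lra.
Qed.

Lemma tanh_sub1 x : 0 <= x -> `|tanh x - 1| <= sech x.
Proof.
move=> x0; have -> : tanh x - 1 = - (expR (- x) * sech x).
  rewrite /tanh /sech.
  have -> : sinh x * (cosh x)^-1 - 1 = (sinh x - cosh x) / cosh x.
    by field; exact: cosh_neq0.
  have -> : sinh x - cosh x = - expR (- x) by rewrite /sinh /cosh; field.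
  by rewrite mulNr.
have s0 := ltW (sech_gt0 x).
by rewrite normrN ger0_norm ?mulr_ge0 ?expR_ge0// ler_piMl// expR_le1 oppr_le0.
Qed.

End hyperbolic.

Lemma int_telescope {R : realType} (K J : int -> R) : K 0 = J 0 ->
  (forall n : int, K n - K (n - 1) = J n - J (n - 1)) -> K =1 J.
Proof.
move=> KJ0 step; elim/int_rect => [//|n IH|n IH].
  have := step n.+1; have -> : n.+1%:Z - 1 = n by rewrite -addn1 PoszD addrK.
  by rewrite IH => /addIr.
have := step (- n%:Z); have -> : - n%:Z - 1 = - n.+1%:Z.
  by rewrite -addn1 PoszD opprD.
by rewrite IH => /addrI /oppr_inj.
Qed.

Section sech_sequence.
Context {R : realType}.
Variable c : R.
Hypothesis c_gt0 : 0 < c.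

Definition odd_int (k : int) : R := (2 * k + 1)%:~R.
Local Notation N := odd_int.

Definition sech_seq (k : int) : R := sech (c * N k).
Local Notation a := sech_seq.

Lemma odd_intE k : N k = 2 * k%:~R + 1.
Proof. by rewrite /odd_int rmorphD rmorphM. Qed.

Lemma odd_intN k : N (- k - 1) = - N k.
Proof. by rewrite !odd_intE rmorphB rmorphN/=; ring. Qed.

Lemma odd_int_ge k : (absz k)%:R <= `|N k|.
Proof.
rewrite odd_intE natr_absz intr_norm; case: (intP k) => [|n|n].
- by rewrite mulr0 add0r normr0 normr1.
- have n0 : 0 <= (n.+1%:Z)%:~R :> R by rewrite ler0z.
  by rewrite !ger0_norm//; lra.
- have n1 : 1 <= n.+1%:R :> R by rewrite ler1n.
  by rewrite rmorphN/= mulrN normrN -(normrN (_ + _)) !ger0_norm//; lra.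
Qed.

Lemma sech_seq_gt0 k : 0 < a k.
Proof. exact: sech_gt0. Qed.

Lemma sech_seqN k : a (- k - 1) = a k.
Proof. by rewrite /sech_seq odd_intN mulrN sechN. Qed.

(** Half of the gap between [s] and [c], called [d], absorbs the power through y^j <= j! exp(y) at y
    = d |N k|; the other half leaves the geometric decay exp(-d |N k|). *)
Lemma sech_seq_weight_summable (s : R) (j : nat) : 0 <= s < c ->
  abs_summable (fun k => a k * (`|N k| ^+ j * expR (s * `|N k|))).
Proof.
move=> /andP[s0 sc]; pose d := (c - s) / 2.
have d0 : 0 < d by rewrite /d; lra.
have r1 : 0 <= expR (- d) < 1 by rewrite expR_ge0 expR_lt1 oppr_lt0.
have pow (y : R) : 0 <= y -> y ^+ j <= j`!%:R * expR y.
  move=> y0; case: j => [|j]; first by rewrite fact0 mul1r expr0 -expR0 ler_expR.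
  rewrite -ler_pdivrMl ?ltr0n ?fact_gt0// mulrC.
  by have := expR_ge1Dxn j y0; lra.
apply: (le_abs_summable _ (abs_summableZ (2 * (d ^- j * j`!%:R)) (geometric_summable r1))) => k.
have Nk := normr_ge0 (N k).
rewrite ger0_norm; last by rewrite !mulr_ge0 ?expR_ge0 ?exprn_ge0// ltW// sech_seq_gt0.
rewrite (le_trans _ (ler_norm _))//.
have h1 : `|N k| ^+ j <= d ^- j * j`!%:R * expR (d * `|N k|).
  have := pow _ (mulr_ge0 (ltW d0) Nk).
  by rewrite exprMn -ler_pdivlMl ?exprn_gt0// mulrA.
have h2 : a k <= 2 * expR (- (c * `|N k|)).
  by have := sech_le (c * N k); rewrite normrM (gtr0_norm c_gt0).
have h3 : expR (- (d * `|N k|)) <= expR (- d) ^+ absz k.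
  rewrite -expRM_natl ler_expR mulrN lerN2 (mulrC _ d) ler_pM2l//.
  exact: odd_int_ge.
apply: (@le_trans _ _ (2 * expR (- (c * `|N k|)) *
    (d ^- j * j`!%:R * expR (d * `|N k|) * expR (s * `|N k|)))).
  rewrite ler_pM ?mulr_ge0 ?exprn_ge0 ?expR_ge0//; first by rewrite ltW// sech_seq_gt0.
  by rewrite ler_wpM2r ?expR_ge0.
have -> : 2 * expR (- (c * `|N k|)) *
    (d ^- j * j`!%:R * expR (d * `|N k|) * expR (s * `|N k|)) =
    2 * (d ^- j * j`!%:R) * (expR (- (c * `|N k|)) * (expR (d * `|N k|) * expR (s * `|N k|))).
  by ring.
rewrite -!expRD.
have -> : - (c * `|N k|) + (d * `|N k| + s * `|N k|) = - (d * `|N k|).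
  by rewrite /d; field.
by rewrite ler_wpM2l// !mulr_ge0 ?invr_ge0 ?exprn_ge0 ?ltW.
Qed.

Lemma sech_seq_summable : abs_summable a.
Proof.
have := @sech_seq_weight_summable 0 0; rewrite lexx c_gt0 => /(_ isT).
by apply: le_abs_summable => k; rewrite expr0 mul1r mul0r expR0 mulr1.
Qed.

Definition tanh_step (p : int) : R := tanh (c * N p) - tanh (c * N (p - 1)).
Local Notation d := tanh_step.

Lemma tanh_stepE p : d p = sinh (2 * c) * (a p * a (p - 1)).
Proof.
rewrite /tanh_step sech_tanhB /sech_seq; congr (sinh _ * _).
by rewrite !odd_intE rmorphB/=; ring.
Qed.

Lemma tanh_stepN p : d (- p) = d p.
Proof.
rewrite /tanh_step odd_intN.
have -> : N (- p) = - N (p - 1) by rewrite !odd_intE rmorphB rmorphN/=; ring.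
by rewrite !mulrN !tanhN; ring.
Qed.

Lemma le_tanh_step p : `|d p| <= `|sinh (2 * c) * a p|.
Proof.
rewrite tanh_stepE mulrA normrM ler_piMr//.
by rewrite gtr0_norm ?sech_gt0 ?sech_le1.
Qed.

Lemma tanh_step_summable : abs_summable d.
Proof.
apply: (le_abs_summable le_tanh_step).
exact: abs_summableZ sech_seq_summable.
Qed.

Lemma tanh_step_moment_summable : abs_summable (fun p => p%:~R * d p).
Proof.
have := @sech_seq_weight_summable 0 1; rewrite lexx c_gt0 => /(_ isT).
move=> /(abs_summableZ (sinh (2 * c))); apply: le_abs_summable => p.
rewrite mul0r expR0 mulr1 expr1 mulrA [leRHS]normrM normrM mulrC.
rewrite ler_pM// ?le_tanh_step// normr_id.
by rewrite -intr_norm -natr_absz odd_int_ge.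
Qed.

(* Subtracting sgn(2p+1) from tanh makes the telescoping terms summable; the
   jump of the sign at p = 0 contributes the 2. *)
Lemma psum_tanh_step : psum d = 2.
Proof.
pose sg (p : int) : R := if 0 <= p then 1 else -1.
pose w p := tanh (c * N p) - sg p.
have ws : abs_summable w.
  apply: (le_abs_summable _ sech_seq_summable) => p.
  rewrite [leRHS]gtr0_norm ?sech_gt0// /w /sg.
  have [p0|p0] := leP 0 p.
    have pR : 0 <= p%:~R :> R by rewrite ler0z.
    have N0 : 0 <= N p by rewrite odd_intE; lra.
    exact/tanh_sub1/(mulr_ge0 (ltW c_gt0)).
  have pR : p%:~R <= (-1)%:~R :> R by rewrite ler_int; lia.
  have N0 : 0 <= - N p by move: pR; rewrite odd_intE mulrN1z; lra.
  rewrite /sech_seq -sechN -normrN opprD opprK -tanhN -mulrN.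
  exact/tanh_sub1/(mulr_ge0 (ltW c_gt0)).
have [s2 p2] := @psum_single R int 0 2.
have ws1 : abs_summable (fun p => w (p - 1)) := abs_summable_reindex (shift_bij 1) ws.
have -> : d = (fun p => (w p - w (p - 1)) + (if p == 0 then 2 else 0)).
  apply/funext => p; rewrite /tanh_step /w /sg.
  case: ifPn => h1; case: ifPn => h2; case: ifPn => h3; rewrite ?(eqP h3); try lia; ring.
rewrite psumD//; last exact: abs_summableB.
by rewrite psumB// p2 -[X in _ - X](psum_reindex w (shift_bij 1)) subrr add0r.
Qed.

Lemma psum_odd {T : choiceType} (u : T -> R) (e : T -> T) : bijective e ->
  abs_summable u -> (forall i, u (e i) = - u i) -> psum u = 0.
Proof.
move=> be us ue; have := psum_reindex u be.
have -> : u \o e = (fun i => - u i) by apply/funext => i; exact: ue.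
by rewrite psumN// => h; lra.
Qed.

Lemma psum_tanh_step_moment : psum (fun p => p%:~R * d p) = 0.
Proof.
apply: (psum_odd (refl_bij 0)); first exact: tanh_step_moment_summable.
by move=> p; rewrite sub0r tanh_stepN rmorphN/= mulNr.
Qed.

(* The odd integers 2i+1 and 2(n-i)+1 add up to 2(n+1), hence the shift by one
   below and in sech_conv3. *)
Definition sech_conv2 (n : int) : R := psum (fun i => a i * a (n - i)).
Local Notation b := sech_conv2.

Lemma sech_conv2_summable : abs_summable b.
Proof. exact: conv_summable sech_seq_summable sech_seq_summable. Qed.

Lemma conv2_row_summable n : abs_summable (fun i => a i * a (n - i)).
Proof. exact: conv_row_summable sech_seq_summable sech_seq_summable. Qed.

(** The left side is a sum of tanh(c N i) + tanh(c N (n - i)). Raising n by one changes it by the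
    total of all tanh increments, which is 2, and both sides vanish at n = -1. The product form
    avoids dividing by sinh 0 there. *)
Lemma sech_conv2E n : b n * sinh (2 * c * (n + 1)%:~R) = 2 * (n + 1)%:~R.
Proof.
pose t n i := tanh (c * N i) + tanh (c * N (n - i)).
have tE m i : sinh (2 * c * (m + 1)%:~R) * (a i * a (m - i)) = t m i.
  rewrite /t -sech_tanhD mulrC; congr (_ * sinh _).
  by rewrite !odd_intE rmorphB rmorphD/=; ring.
have ts m : abs_summable (t m).
  have := abs_summableZ (sinh (2 * c * (m + 1)%:~R)) (conv2_row_summable m).
  by apply: le_abs_summable => i; rewrite tE.
have BE m : b m * sinh (2 * c * (m + 1)%:~R) = psum (t m).
  rewrite mulrC -psumZ; last exact: conv2_row_summable.
  by apply: eq_psum => i; rewrite tE.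
suff H : (fun n => b (n - 1) * sinh (2 * c * n%:~R)) =1 (fun n : int => 2 * n%:~R).
  by have := H (n + 1); rewrite /= addrK.
apply: int_telescope => [|{}n]; first by rewrite !mulr0 sinh0 mulr0.
have h (m : int) : b (m - 1) * sinh (2 * c * m%:~R) = psum (t (m - 1)).
  by rewrite -BE subrK.
rewrite !h -psumB// rmorphB/=.
transitivity (psum d); last by rewrite psum_tanh_step; ring.
rewrite (psum_reindex d (refl_bij (n - 1))); apply: eq_psum => i.
rewrite /t /tanh_step /=.
have -> : n - 1 - i - 1 = n - 1 - 1 - i by ring.
by ring.
Qed.

Definition sech_conv3 (n : int) : R := psum (fun m => b m * a (n - m)).
Local Notation g := sech_conv3.

Lemma conv3_row_summable n : abs_summable (fun m => b m * a (n - m)).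
Proof. exact: conv_row_summable sech_conv2_summable sech_seq_summable. Qed.

(** The initial value of the telescoping: it is chosen so that the formula for [g n] holds at n =
    -1, where [N 0] is 1. *)
Definition sech_const : R := 2 * (g (-1) * cosh (c * N 0)) - 1.

(** After multiplication by cosh(c N n), [cosh_sech] splits each term into a cosh, which cancels
    between consecutive n, and a sinh times tanh, where [sech_conv2E] replaces [b i] times sinh by
    2(i + 1). The increment is thus the sum of 2(n - p) against the tanh steps, that is 4n, and 4n
    is the increment of 2n(n + 1) = (N n ^ 2 - 1) / 2. *)
Theorem sech_conv3E n : g n = a (n + 1) * ((N (n + 1) ^+ 2 + sech_const) / 2).
Proof.
suff H : (fun n => g (n - 1) * cosh (c * N n)) =1
    (fun n : int => 2 * n%:~R * (n%:~R + 1) + g (-1) * cosh (c * N 0)).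
  have := H (n + 1); rewrite /= addrK => h.
  have -> : g n = a (n + 1) * (g n * cosh (c * N (n + 1))).
    by rewrite /sech_seq /sech; field; exact: cosh_neq0.
  by rewrite h /sech_const odd_intE; field.
apply: int_telescope => [|{}n]; first by rewrite sub0r mulr0z mulr0 mul0r add0r.
rewrite mulrC (mulrC (g (n - 1 - 1))) -!psumZ; try exact: conv3_row_summable.
have s m k : abs_summable (fun i => cosh (c * N m) * (b i * a (k - i))).
  exact/abs_summableZ/conv3_row_summable.
rewrite -psumB//.
have e i : cosh (c * N n) * (b i * a (n - 1 - i)) -
    cosh (c * N (n - 1)) * (b i * a (n - 1 - 1 - i)) =
    2 * ((i + 1)%:~R * d (n - 1 - i)).
  have cE (m : int) : cosh (c * N m) * a (m - 1 - i) =
      cosh (2 * c * (i + 1)%:~R) + sinh (2 * c * (i + 1)%:~R) * tanh (c * N (m - 1 - i)).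
    rewrite -cosh_sech mulrC; congr (_ * cosh _).
    by rewrite !odd_intE !rmorphB rmorphD/=; ring.
  have -> : d (n - 1 - i) = tanh (c * N (n - 1 - i)) - tanh (c * N (n - 1 - 1 - i)).
    by rewrite /tanh_step; have -> : n - 1 - i - 1 = n - 1 - 1 - i by ring.
  move: (sech_conv2E i) (cE n) (cE (n - 1)).
  move: (b i) (a (n - 1 - i)) (a (n - 1 - 1 - i)) (sinh _) (cosh (2 * c * _)).
  move: (tanh (c * N (n - 1 - i))) (tanh (c * N (n - 1 - 1 - i))) (cosh (c * N n)).
  move: (cosh (c * N (n - 1))) ((i + 1)%:~R : R) => C2 I t1 t2 C1 B A1 A2 sh ch hB h1 h2.
  have -> : C1 * (B * A1) - C2 * (B * A2) = B * (C1 * A1) - B * (C2 * A2) by ring.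
  by rewrite h1 h2 mulrA -hB; ring.
rewrite (eq_psum e).
transitivity (psum (fun p => 2 * (n%:~R * d p - p%:~R * d p))).
  rewrite [RHS](psum_reindex _ (refl_bij (n - 1))); apply: eq_psum => i /=.
  by rewrite !rmorphB rmorphD/=; ring.
have ds := tanh_step_summable; have dms := tanh_step_moment_summable.
have nds := abs_summableZ n%:~R ds.
rewrite psumZ; last exact: abs_summableB.
rewrite psumB// psumZ// psum_tanh_step psum_tanh_step_moment rmorphB/=.
by ring.
Qed.

End sech_sequence.

(** * Generating functions *)

Section taylor.
Context {R : realType}.
Implicit Types (g : R -> R) (x h : R).

Lemma mean_value_at g g1 x h : (forall y : R, is_derive y 1 g (g1 y)) ->
  exists2 y, `|y - x| <= `|h| & g (x + h) - g x = h * g1 y.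
Proof.
move=> dg.
have cg u v : {within `[u, v], continuous g}.
  by apply: derivable_within_continuous => y _; have [] := dg y.
have [h0|h0|->] := ltgtP h 0; last first.
- by exists x; rewrite ?subrr ?normr0// addr0 subrr mul0r.
- have xh : x < x + h by rewrite ltrDl.
  have [y] := MVT xh (fun y _ => dg y) (cg _ _).
  rewrite in_itv/= => /andP[xy yh] e; exists y.
    by rewrite !ger0_norm ?subr_ge0 1?ltW//; lra.
  by rewrite e addrAC subrr add0r mulrC.
- have xh : x + h < x by rewrite gtrDl.
  have [y] := MVT xh (fun y _ => dg y) (cg _ _).
  rewrite in_itv/= => /andP[xy yh] e; exists y.
    by rewrite (ltr0_norm h0) ler0_norm ?subr_le0 ?ltW//; lra.
  by rewrite -opprB e opprD addrA subrr sub0r mulrN opprK mulrC.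
Qed.

Lemma taylor2_bound g g1 g2 x h (K : R) :
  (forall y : R, is_derive y 1 g (g1 y)) ->
  (forall y : R, is_derive y 1 g1 (g2 y)) ->
  (forall y, `|y - x| <= `|h| -> `|g2 y| <= K) ->
  `|g (x + h) - g x - h * g1 x| <= K * h ^+ 2.
Proof.
move=> dg dg1 gK.
have [y yh ->] := mean_value_at x h dg.
have [z zy e] := mean_value_at x (y - x) dg1.
have xy : x + (y - x) = y by ring.
rewrite xy in e.
rewrite -mulrBr e !normrM mulrA mulrC.
rewrite ler_pM ?mulr_ge0//; first by rewrite gK// (le_trans zy).
by rewrite -[h ^+ 2]real_normK ?num_real// expr2 ler_pM.
Qed.

Lemma is_derive_expRM (n : R) (y : R) :
  is_derive y 1 (fun t : R => expR (n * t)) (n * expR (n * y)).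
Proof.
have l : is_derive y 1 (fun t : R => n * t) n by derive; ring.
by apply: is_derive_eq; rewrite /GRing.scale/= mulrC.
Qed.

Lemma is_derive_cosM (n : R) (y : R) :
  is_derive y 1 (fun t : R => cos (n * t)) (- (n * sin (n * y))).
Proof.
have l : is_derive y 1 (fun t : R => n * t) n by derive; ring.
by apply: is_derive_eq; rewrite /GRing.scale/=; ring.
Qed.

Lemma is_derive_sinM (n : R) (y : R) :
  is_derive y 1 (fun t : R => sin (n * t)) (n * cos (n * y)).
Proof.
have l : is_derive y 1 (fun t : R => n * t) n by derive; ring.
by apply: is_derive_eq; rewrite /GRing.scale/= mulrC.
Qed.

End taylor.

Section generating_functions.
Context {R : realType}.
Variable c : R.
Hypothesis c_gt0 : 0 < c.
Local Notation N := (@odd_int R).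
Local Notation a := (sech_seq c).
Local Notation L := (sech_const c).

(** The j-th derivative of the exponential generating function of [a]; at t = 0 it is the
    unnormalised j-th moment. *)
Definition exp_moment (j : nat) (t : R) : R :=
  psum (fun k => a k * (N k ^+ j * expR (N k * t))).
Local Notation f := exp_moment.

Lemma exp_moment_summable j t : `|t| < c ->
  abs_summable (fun k => a k * (N k ^+ j * expR (N k * t))).
Proof.
move=> tc; have := @sech_seq_weight_summable _ _ c_gt0 `|t| j.
rewrite normr_ge0 tc => /(_ isT); apply: le_abs_summable => k.
rewrite !normrM ler_wpM2l// !normrX normr_id ler_wpM2l ?exprn_ge0//.
rewrite !(ger0_norm (expR_ge0 _)) ler_expR (le_trans (ler_norm _))//.
by rewrite normrM mulrC.
Qed.

Lemma exp_moment_drv j (t : R) : `|t| < c -> is_derive t 1 (f j) (f j.+1 t).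
Proof.
(* Half of the distance to [c], so that the exponent |t| + r of the majorant stays below [c]. *)
move=> tc; pose r := (c - `|t|) / 2.
have r0 : 0 < r by rewrite /r; lra.
have rc : `|t| + r < c by rewrite /r; lra.
have tr0 : 0 <= `|t| + r by rewrite addr_ge0// ltW.
have Ms := @sech_seq_weight_summable _ _ c_gt0 (`|t| + r) j.+2.
apply: (@is_derive_psum _ _ (fun t k => a k * (N k ^+ j * expR (N k * t)))
  (fun t k => a k * (N k ^+ j.+1 * expR (N k * t)))
  (fun k => a k * (`|N k| ^+ j.+2 * expR ((`|t| + r) * `|N k|))) t r r0)
  => [|y yt||k h hr].
- by apply: Ms; rewrite tr0.
- apply: exp_moment_summable; rewrite (le_lt_trans _ rc)//.
  have -> : y = t + (y - t) by rewrite addrC subrK.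
  by rewrite (le_trans (ler_normD _ _))// lerD2l ltW.
- exact: exp_moment_summable.
have drv i (y : R) : is_derive y 1 (fun t => a k * (N k ^+ i * expR (N k * t)))
    (a k * (N k ^+ i.+1 * expR (N k * y))).
  have e := is_derive_expRM (N k) y.
  derive; rewrite exprS.
  move: (a k) (N k) (expR _) => u v w; ring.
apply: (@taylor2_bound _ (fun t => a k * (N k ^+ j * expR (N k * t)))
  (fun t => a k * (N k ^+ j.+1 * expR (N k * t)))
  (fun t => a k * (N k ^+ j.+2 * expR (N k * t)))) => //.
move=> y yh; rewrite normrM normrM (gtr0_norm (sech_seq_gt0 c k)).
rewrite ler_wpM2l ?(ltW (sech_seq_gt0 c k))// normrX ler_wpM2l ?exprn_ge0//.
rewrite ger0_norm ?expR_ge0// ler_expR (le_trans (ler_norm _))//.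
rewrite normrM mulrC ler_wpM2r//.
have -> : y = t + (y - t) by rewrite addrC subrK.
by rewrite (le_trans (ler_normD _ _))// lerD2l (le_trans yh)// ltW.
Qed.

Lemma exp_moment_odd j : odd j -> f j 0 = 0.
Proof.
move=> oj; apply: (psum_odd (refl_bij (-1))).
  by apply: exp_moment_summable; rewrite normr0.
move=> k; have -> : -1 - k = - k - 1 by rewrite addrC.
rewrite sech_seqN odd_intN !mulr0 exprNn -signr_odd oj expr1.
by rewrite mulN1r mulNr mulrN.
Qed.

Lemma exp_moment_even_gt0 j t : ~~ odd j -> `|t| < c -> 0 < f j t.
Proof.
move=> oj tc; apply: (@psum_gt0 _ _ _ 0).
- move=> k; rewrite mulr_ge0 ?mulr_ge0 ?expR_ge0 ?(ltW (sech_seq_gt0 _ _))//.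
  by rewrite exprn_even_ge0.
- exact: exp_moment_summable.
- have -> : N 0 = 1 by rewrite odd_intE mulr0 add0r.
  by rewrite expr1n !mul1r mulr_gt0 ?expR_gt0 ?sech_seq_gt0.
Qed.

Lemma exp_moment1_gt0 t : 0 < t < c -> 0 < f 1 t.
Proof.
move=> /andP[t0 tc].
have dom x : 0 <= x <= t -> `|x| < c.
  by move=> /andP[x0 xt]; rewrite ger0_norm// (le_lt_trans xt).
have df (x : R) : x \in `]0, t[ -> is_derive x 1 (f 1) (f 2 x).
  rewrite in_itv/= => /andP[x0 xt].
  by apply: exp_moment_drv; apply: dom; rewrite !ltW.
have cf : {within `[0, t], continuous (f 1)}.
  apply: derivable_within_continuous => x; rewrite in_itv/= => xt.
  by have [] := exp_moment_drv 1 (dom x xt).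
have [x] := MVT t0 df cf; rewrite in_itv/= exp_moment_odd// !subr0.
move=> /andP[x0 xt] ->; rewrite mulr_gt0// exp_moment_even_gt0//.
by apply: dom; rewrite !ltW.
Qed.

(** The cube of [f 0] is the generating function of [sech_conv3], whose weight (N^2 + L) / 2 stands
    for (f'' + L f) / 2. The reindexing by one matches the exponent N(n + 1) with the index n. *)
Lemma exp_moment_ode t : `|t| < c -> f 2 t = 2 * f 0 t ^+ 3 - L * f 0 t.
Proof.
move=> tc.
have s := exp_moment_summable _ tc.
pose u k := a k * expR (N k * t).
have us : abs_summable u.
  by have := s 0%N; apply: le_abs_summable => k; rewrite expr0 mul1r.
have f0 : f 0 t = psum u by apply: eq_psum => k; rewrite expr0 mul1r.
pose v n := sech_conv2 c n * expR ((2 * (n + 1))%:~R * t).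
have ve n : psum (fun m => u m * u (n - m)) = v n.
  rewrite /v mulrC -psumZ; last exact: conv2_row_summable.
  apply: eq_psum => m; rewrite /u.
  have -> : (2 * (n + 1))%:~R * t = N m * t + N (n - m) * t.
    by rewrite -mulrDl; congr (_ * t); rewrite !odd_intE rmorphM rmorphD rmorphB/=; ring.
  by rewrite expRD; move: (a m) (a (n - m)) (expR _) (expR (N m * t)) => *; ring.
have vs : abs_summable v.
  have := conv_summable us us; apply: le_abs_summable => n.
  by rewrite ve.
have f02 : f 0 t * f 0 t = psum v.
  by rewrite f0 psum_mul//; apply: eq_psum => n; rewrite ve.
pose w k := a k * ((N k ^+ 2 + L) / 2) * expR (N k * t).
have f03 : f 0 t ^+ 3 = psum w.
  rewrite exprSr expr2 f02 f0 psum_mul// (psum_reindex w (shift_bij (-1))).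
  apply: eq_psum => n /=; rewrite opprK /w -sech_conv3E//.
  rewrite [RHS]mulrC -psumZ; last exact: conv3_row_summable.
  apply: eq_psum => m; rewrite /u /v.
  have -> : N (n + 1) * t = (2 * (m + 1))%:~R * t + N (n - m) * t.
    by rewrite -mulrDl; congr (_ * t); rewrite !odd_intE rmorphM !rmorphD rmorphN/=; ring.
  rewrite expRD; move: (sech_conv2 c m) (a (n - m)) (expR _) (expR (N (n - m) * t)) => *.
  by ring.
have wE k : w k = 2^-1 * (a k * (N k ^+ 2 * expR (N k * t))) +
    L / 2 * (a k * (N k ^+ 0 * expR (N k * t))).
  by rewrite /w expr0; move: (a k) (N k) (expR _) L => *; field.
rewrite f03 (eq_psum wE) psumD; [|exact/abs_summableZ/s..].
rewrite !psumZ; [|exact: s..].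
by rewrite -/(f 2 t) -/(f 0 t); move: (f 2 t) (f 0 t) L => *; field.
Qed.

Lemma exp_moment_sum0 : f 0 0 = psum a.
Proof. by apply: eq_psum => k; rewrite expr0 mulr0 expR0 !mulr1. Qed.

Let moment_summable j : abs_summable (fun k => a k * N k ^+ j).
Proof.
have /(exp_moment_summable j) : `|0 : R| < c by rewrite normr0.
by apply: le_abs_summable => k; rewrite mulr0 expR0 mulr1.
Qed.

Let weighted_summable j (x : int -> R) : (forall k, `|x k| <= 1) ->
  abs_summable (fun k => a k * (N k ^+ j * x k)).
Proof.
move=> x1; apply: (le_abs_summable _ (moment_summable j)) => k.
by rewrite mulrA normrM ler_piMr.
Qed.

Definition cos_sum (t : R) : R := psum (fun k => a k * cos (N k * t)).
Definition sin_moment (t : R) : R := psum (fun k => a k * (N k * sin (N k * t))).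
Definition cos_moment (t : R) : R := psum (fun k => a k * (N k ^+ 2 * cos (N k * t))).

Let cs t : abs_summable (fun k => a k * cos (N k * t)).
Proof.
have := weighted_summable 0 (fun k => cos_max (N k * t)).
by apply: le_abs_summable => k; rewrite expr0 mul1r.
Qed.

Let ss t : abs_summable (fun k => a k * sin (N k * t)).
Proof.
have := weighted_summable 0 (fun k => sin_max (N k * t)).
by apply: le_abs_summable => k; rewrite expr0 mul1r.
Qed.

Let sms t : abs_summable (fun k => a k * (N k * sin (N k * t))).
Proof.
exact: (weighted_summable 1 (fun k => sin_max (N k * t))).
Qed.

Let cms t : abs_summable (fun k => a k * (N k ^+ 2 * cos (N k * t))).
Proof. exact: (weighted_summable 2 (fun k => cos_max (N k * t))). Qed.

Let normr_moment_summable j : abs_summable (fun k => a k * `|N k| ^+ j).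
Proof.
apply: (le_abs_summable _ (moment_summable j)) => k.
by rewrite !normrM !normrX normr_id.
Qed.

Lemma cos_sum_drv (t : R) : is_derive t 1 cos_sum (- sin_moment t).
Proof.
have -> : - sin_moment t = psum (fun k => - (a k * (N k * sin (N k * t)))).
  by rewrite psumN.
apply: (@is_derive_psum _ _ (fun t k => a k * cos (N k * t))
  (fun t k => - (a k * (N k * sin (N k * t))))
  (fun k => a k * `|N k| ^+ 2) t 1 ltr01) => [|y _||k h _].
- exact: normr_moment_summable.
- exact: cs.
- exact/abs_summableN/sms.
apply: (@taylor2_bound _ (fun t => a k * cos (N k * t))
  (fun t => - (a k * (N k * sin (N k * t))))
  (fun t => - (a k * (N k ^+ 2 * cos (N k * t))))).
- move=> y; have e := is_derive_cosM (N k) y; derive.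
  by move: (a k) (N k) (sin _) => *; ring.
- move=> y; have e := is_derive_sinM (N k) y; derive.
  by move: (a k) (N k) (cos _) => *; ring.
move=> y _; rewrite normrN normrM normrM (gtr0_norm (sech_seq_gt0 c k)).
rewrite ler_wpM2l ?(ltW (sech_seq_gt0 c k))// normrX ler_piMr ?exprn_ge0//.
exact: cos_max.
Qed.

Lemma sin_moment_drv (t : R) : is_derive t 1 (fun y => - sin_moment y) (- cos_moment t).
Proof.
suff h : is_derive t 1 sin_moment (cos_moment t) by derive.
apply: (@is_derive_psum _ _ (fun t k => a k * (N k * sin (N k * t)))
  (fun t k => a k * (N k ^+ 2 * cos (N k * t)))
  (fun k => a k * `|N k| ^+ 3) t 1 ltr01) => [|y _||k h _].
- exact: normr_moment_summable.
- exact: sms.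
- exact: cms.
apply: (@taylor2_bound _ (fun t => a k * (N k * sin (N k * t)))
  (fun t => a k * (N k ^+ 2 * cos (N k * t)))
  (fun t => - (a k * (N k ^+ 3 * sin (N k * t))))).
- move=> y; have e := is_derive_sinM (N k) y; derive.
  by move: (a k) (N k) (cos _) => *; ring.
- move=> y; have e := is_derive_cosM (N k) y; derive.
  by move: (a k) (N k) (sin _) => *; ring.
move=> y _; rewrite normrN normrM normrM (gtr0_norm (sech_seq_gt0 c k)).
rewrite ler_wpM2l ?(ltW (sech_seq_gt0 c k))// normrX ler_piMr ?exprn_ge0//.
exact: sin_max.
Qed.

Lemma sin_sum0 t : psum (fun k => a k * sin (N k * t)) = 0.
Proof.
apply: (psum_odd (refl_bij (-1))) => // k.
have -> : -1 - k = - k - 1 by rewrite addrC.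
by rewrite sech_seqN odd_intN mulNr sinN mulrN.
Qed.

(** Cosines are not multiplicative, but the sine sum is 0 by symmetry. Subtracting products of sine
    sums therefore changes nothing and completes each product of cosines to the addition formula,
    after which the convolutions apply as for exponentials. *)
Lemma cos_moment_ode t : cos_moment t = 2 * cos_sum t ^+ 3 - L * cos_sum t.
Proof.
pose u k := a k * cos (N k * t); pose u' k := a k * sin (N k * t).
have us : abs_summable u := cs t; have us' : abs_summable u' := ss t.
pose x n := (2 * (n + 1))%:~R * t.
pose v n := sech_conv2 c n * cos (x n); pose v' n := sech_conv2 c n * sin (x n).
have bs : abs_summable (sech_conv2 c) := sech_conv2_summable c_gt0.
have vs : abs_summable v.
  by apply: (le_abs_summable _ bs) => n; rewrite normrM ler_piMr// cos_max.
have vs' : abs_summable v'.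
  by apply: (le_abs_summable _ bs) => n; rewrite normrM ler_piMr// sin_max.
have rs (p q : int -> R) n : abs_summable p -> abs_summable q ->
  abs_summable (fun m => p m * q (n - m)) := conv_row_summable n.
have u'0 : psum u' = 0 := sin_sum0 t.
have F2 : cos_sum t * cos_sum t = psum v.
  have -> : cos_sum t * cos_sum t = psum u * psum u - psum u' * psum u'.
    by rewrite u'0 mul0r subr0.
  rewrite !psum_mul// -psumB; try exact: conv_summable.
  apply: eq_psum => n; rewrite -psumB; try exact: rs.
  rewrite /v mulrC -psumZ; last exact: conv2_row_summable.
  apply: eq_psum => m; rewrite /u /u'.
  have -> : x n = N m * t + N (n - m) * t.
    by rewrite /x -mulrDl; congr (_ * t); rewrite !odd_intE rmorphM rmorphD rmorphB/=; ring.
  rewrite cosD; move: (a m) (a (n - m)) (cos _) (cos (N (n - m) * t)) => ? ? ? ?.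
  by move: (sin _) (sin (N (n - m) * t)) => *; ring.
pose w k := a k * ((N k ^+ 2 + L) / 2) * cos (N k * t).
have F3 : cos_sum t ^+ 3 = psum w.
  have -> : cos_sum t ^+ 3 = psum v * psum u - psum v' * psum u'.
    by rewrite u'0 mulr0 subr0 exprSr expr2 F2.
  rewrite !psum_mul// -psumB; try exact: conv_summable.
  rewrite (psum_reindex w (shift_bij (-1))).
  apply: eq_psum => n /=; rewrite opprK /w -sech_conv3E// -psumB; try exact: rs.
  rewrite [RHS]mulrC -psumZ; last exact: conv3_row_summable.
  apply: eq_psum => m; rewrite /u /u' /v /v'.
  have -> : N (n + 1) * t = x m + N (n - m) * t.
    by rewrite /x -mulrDl; congr (_ * t); rewrite !odd_intE rmorphM !rmorphD rmorphN/=; ring.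
  rewrite cosD; move: (sech_conv2 c m) (a (n - m)) (cos _) (cos (N (n - m) * t)) => ? ? ? ?.
  by move: (sin _) (sin (N (n - m) * t)) => *; ring.
have wE k : w k = 2^-1 * (a k * (N k ^+ 2 * cos (N k * t))) +
    L / 2 * (a k * cos (N k * t)).
  by rewrite /w; move: (a k) (N k) (cos _) L => *; field.
rewrite F3 (eq_psum wE) psumD; [|exact/abs_summableZ/cms|exact/abs_summableZ/cs].
rewrite !psumZ; [|exact: cms|exact: cs].
rewrite -/(cos_moment t) -/(cos_sum t); move: (cos_moment t) (cos_sum t) L => *.
by field.
Qed.

Lemma cos_sum0 : cos_sum 0 = psum a.
Proof. by apply: eq_psum => k; rewrite mulr0 cos0 mulr1. Qed.

Lemma sin_moment0 : sin_moment 0 = 0.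
Proof.
have [z pz] := @psum_single R int 0 0.
rewrite -[RHS]pz; apply: eq_psum => k; rewrite mulr0 sin0 !mulr0.
by case: ifP.
Qed.

Lemma cos_odd_pihalf (k : int) : cos (N k * (pi / 2)) = 0.
Proof.
have -> : N k * (pi / 2) = k%:~R * pi + pi / 2 by rewrite odd_intE; field.
rewrite cosDpihalf; suff -> : sin (k%:~R * pi) = 0 :> R by rewrite oppr0.
have nat_sin (n : nat) : sin (n%:R * pi) = 0 :> R.
  elim: n => [|n IH]; first by rewrite mul0r sin0.
  by rewrite -natr1 mulrDl mul1r sinDpi IH oppr0.
case: k => n; first exact: nat_sin.
by rewrite NegzE rmorphN/= mulNr sinN nat_sin oppr0.
Qed.

Lemma cos_sum_pihalf : cos_sum (pi / 2) = 0.
Proof.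
have [z pz] := @psum_single R int 0 0.
rewrite -[RHS]pz; apply: eq_psum => k; rewrite cos_odd_pihalf mulr0.
by case: ifP.
Qed.

(** Every cosine lies between -1 and 1, and strictly so for k = 0, where it is cos t; hence G - F
    and G + F are both positive. *)
Lemma cos_sum_sqr_lt t : 0 < t <= pi / 2 -> cos_sum t ^+ 2 < psum a ^+ 2.
Proof.
move=> /andP[t0 tp].
have p0 := pi_gt0 R.
have as_ := sech_seq_summable c_gt0.
have N0 : N 0 = 1 by rewrite odd_intE mulr0 add0r.
have ct1 : cos t < 1.
  by rewrite -cos0 ltr_cos// in_itv/=; apply/andP; split; lra.
have ct0 : 0 <= cos t by rewrite cos_ge0_pihalf//; apply/andP; split; lra.
have lo : 0 < psum a - cos_sum t.
  rewrite -psumB//; apply: (@psum_gt0 _ _ _ 0); last 2 first.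
  - exact: abs_summableB.
  - by rewrite N0 mul1r subr_gt0 gtr_pMr ?sech_seq_gt0.
  by move=> k; rewrite subr_ge0 ger_pMr ?sech_seq_gt0// cos_le1.
have hi : 0 < psum a + cos_sum t.
  rewrite -psumD//; apply: (@psum_gt0 _ _ _ 0); last 2 first.
  - exact: abs_summableD.
  - by rewrite N0 mul1r ltr_wpDr ?sech_seq_gt0// mulr_ge0// ltW// sech_seq_gt0.
  move=> k; rewrite -[X in X + _]mulr1 -mulrDr mulr_ge0 ?(ltW (sech_seq_gt0 _ _))//.
by rewrite -subr_gt0 subr_sqr mulr_gt0.
Qed.

Lemma ler_sum_psum (u : int -> R) (n : nat) : (forall k, 0 <= u k) ->
  abs_summable u -> \sum_(i < n) u i%:Z <= psum u.
Proof.
move=> u0 us.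
pose v m (k : int) := if 0 <= k < m%:Z then u k else 0.
have vs m : abs_summable (v m).
  apply: (le_abs_summable _ us) => k; rewrite /v; case: ifP => _ //.
  by rewrite normr0.
have <- : psum (v n) = \sum_(i < n) u i%:Z.
  elim: n => [|n IH].
    rewrite big_ord0; have [_ <-] := @psum_single R int 0 0.
    apply: eq_psum => k; rewrite /v; case: ifP => h1; case: ifP => // _; lia.
  rewrite big_ord_recr/= -IH.
  have [s p] := psum_single (n%:Z) (u n%:Z).
  rewrite -[X in _ + X]p -psumD//; apply: eq_psum => k; rewrite /v.
  case: ifPn => h1; case: ifPn => h2; case: ifPn => h3; rewrite ?addr0 ?add0r//; try lia.
  by rewrite (eqP h3).
apply: le_psum => // k; rewrite /v; case: ifP => // _; exact: u0.
Qed.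

(** As soon as c - t < 1/(4n), each of the n terms with 0 <= k < n is at least exp(-(c - t) N k) >=
    1 - 2n/(4n) = 1/2, so f is at least n/2. *)
Lemma exp_moment_blowup : (f 0 t)^-1 @[t --> c^'-] --> 0.
Proof.
apply/cvgrPdist_le => e e0.
pose n := (Num.bound (2 / e)).+1.
have n0 : 0 < n%:R :> R by rewrite ltr0n.
have ne : 2 / e < n%:R.
  rewrite (@lt_le_trans _ _ (Num.bound (2 / e))%:R) ?ler_nat//.
  by rewrite archi_boundP// ltW// divr_gt0.
have dl0 : 0 < (4 * n%:R)^-1 :> R by rewrite invr_gt0 mulr_gt0.
near=> t.
have tc : t < c by near: t; exact: nbhs_left_lt.
have t0 : 0 < t by near: t; exact: nbhs_left_gt.
have tn : c - t < (4 * n%:R)^-1 by near: t; exact: nbhs_left_ltBl.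
have tcn : `|t| < c by rewrite gtr0_norm.
have us := exp_moment_summable 0 tcn.
have u0 k : 0 <= a k * (N k ^+ 0 * expR (N k * t)).
  by rewrite !mulr_ge0 ?expR_ge0// ltW// sech_seq_gt0.
have : n%:R / 2 <= f 0 t.
  apply: le_trans (ler_sum_psum n u0 us).
  rewrite mulr_natl -[n in _ *+ n]card_ord -sumr_const; apply: ler_sum => i _.
  have Ni : N i%:Z = 2 * i%:R + 1 by rewrite odd_intE.
  have iR : i%:R + 1 <= n%:R :> R by rewrite natr1 ler_nat ltn_ord.
  have i0 : 0 <= i%:R :> R by [].
  rewrite expr0 mul1r.
  have ha : expR (- (c * N i%:Z)) <= a i%:Z.
    have := sech_lower (c * N i%:Z); rewrite ger0_norm//.
    by rewrite Ni mulr_ge0 ?ltW//; lra.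
  apply: (@le_trans _ _ (expR (- (c * N i%:Z)) * expR (N i%:Z * t))); last first.
    by rewrite ler_wpM2r ?expR_ge0.
  rewrite -expRD; apply: le_trans (expR_ge1Dx _).
  have -> : - (c * N i%:Z) + N i%:Z * t = - ((c - t) * N i%:Z) by ring.
  have : (c - t) * N i%:Z <= (4 * n%:R)^-1 * (2 * n%:R).
    by rewrite ler_pM ?Ni ?ltW//; lra.
  have -> : (4 * n%:R)^-1 * (2 * n%:R) = 2^-1 :> R by field; rewrite gt_eqF.
  by lra.
move=> fn; have fp : 0 < f 0 t by rewrite (lt_le_trans _ fn)// divr_gt0.
rewrite sub0r normrN gtr0_norm ?invr_gt0// -[e]invrK lef_pV2 ?posrE ?invr_gt0//.
rewrite (le_trans _ fn)//; move: ne; rewrite ltr_pdivrMr// ler_pdivlMr// => ne.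
by rewrite mulrC ler_pdivrMr// ltW.
Unshelve. all: by end_near. Qed.

End generating_functions.

(** * The parameter pi/2: vanishing of the constant and values of the moments *)

Section lemniscatic_case.
Context {R : realType}.
Local Notation c := (pi / 2 : R).
Local Notation f := (exp_moment c).

Let c_gt0 : 0 < c. Proof. by have := pi_gt0 R; lra. Qed.

(** The only place where the value of the parameter matters: for every c the cosine sum vanishes at
    pi/2 and the exponential sum blows up at c, and these two points coincide for c = pi/2. The
    comparison is applied with [- sech_const c] as its constant. *)
Lemma sech_const_pihalf : sech_const c = 0.
Proof.
pose G := psum (sech_seq c).
have G0 : 0 < G.
  apply: (@psum_gt0 _ _ _ 0); last exact: sech_seq_gt0.
  - by move=> k; rewrite ltW// sech_seq_gt0.
  - exact: sech_seq_summable.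
have tc (t : R) : 0 <= t < c -> `|t| < c by move=> /andP[t0 tc]; rewrite ger0_norm.
apply/eqP; rewrite -oppr_eq0; apply/eqP.
apply: (@quarter_period_self_dual _ c G (- sech_const c) (cos_sum c)
  (fun t => - sin_moment c t) (f 0) (f 1)) => //.
- exact: cos_sum_drv.
- move=> t; have -> : - (- sech_const c * cos_sum c t) - 2 * cos_sum c t ^+ 3 =
      - cos_moment c t.
    by rewrite cos_moment_ode//; move: (cos_sum _ _) (sech_const _) => *; ring.
  exact: sin_moment_drv.
- by move=> t /tc; exact: exp_moment_drv.
- move=> t /tc ht; have -> : - sech_const c * f 0 t + 2 * f 0 t ^+ 3 = f 2 t.
    by rewrite exp_moment_ode//; move: (f _ _) (sech_const _) => *; ring.
  exact: exp_moment_drv.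
- exact: cos_sum0.
- by rewrite sin_moment0 oppr0.
- exact: exp_moment_sum0.
- exact: exp_moment_odd.
- exact: cos_sum_pihalf.
- exact: cos_sum_sqr_lt.
- exact: exp_moment1_gt0.
- exact: exp_moment_blowup.
Qed.

Lemma derive_eq_on (p q p1 q1 : R -> R) :
  (forall t, `|t| < c -> p t = q t) ->
  (forall t : R, `|t| < c -> is_derive t 1 p (p1 t)) ->
  (forall t : R, `|t| < c -> is_derive t 1 q (q1 t)) ->
  forall t, `|t| < c -> p1 t = q1 t.
Proof.
move=> pq dp dq t tc.
have [_ <-] := dq t tc.
have : is_derive t 1 q (p1 t).
  apply: (near_eq_is_derive _ (dp t tc)); near=> y; apply: pq.
  near: y; apply: (@cvgr_norm_lt _ _ _ _ _ id t) => //; exact: cvg_id.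
by case=> _ ->.
Unshelve. all: by end_near. Qed.

Lemma even_moments :
  [/\ f 2 0 = 2 * f 0 0 ^+ 3, f 4 0 = 12 * f 0 0 ^+ 5,
      f 6 0 = 216 * f 0 0 ^+ 7 & f 8 0 = 7056 * f 0 0 ^+ 9].
Proof.
have dr j (t : R) : `|t| < c -> is_derive t 1 (f j) (f j.+1 t) by exact: exp_moment_drv.
have f2 t : `|t| < c -> f 2 t = 2 * f 0 t ^+ 3.
  by move=> tc; rewrite exp_moment_ode// sech_const_pihalf mul0r subr0.
have d0 := dr 0%N; have d1 := dr 1%N; have d2 := dr 2%N; have d3 := dr 3%N.
have d4 := dr 4%N; have d5 := dr 5%N; have d6 := dr 6%N; have d7 := dr 7%N.
have f3 : forall t, `|t| < c -> f 3 t = 6 * f 0 t ^+ 2 * f 1 t.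
  apply: (derive_eq_on f2 d2) => t tc; have e0 := d0 t tc.
  by derive; move: (f 0 t) (f 1 t) => *; ring.
have f4 : forall t, `|t| < c ->
    f 4 t = 12 * f 0 t * f 1 t ^+ 2 + 6 * f 0 t ^+ 2 * f 2 t.
  apply: (derive_eq_on f3 d3) => t tc; have e0 := d0 t tc; have e1 := d1 t tc.
  by derive; move: (f 0 t) (f 1 t) (f 2 t) => *; ring.
have f5 : forall t, `|t| < c -> f 5 t =
    12 * f 1 t ^+ 3 + 36 * f 0 t * f 1 t * f 2 t + 6 * f 0 t ^+ 2 * f 3 t.
  apply: (derive_eq_on f4 d4) => t tc.
  have e0 := d0 t tc; have e1 := d1 t tc; have e2 := d2 t tc.
  by derive; move: (f 0 t) (f 1 t) (f 2 t) (f 3 t) => *; ring.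
have f6 : forall t, `|t| < c -> f 6 t =
    72 * f 1 t ^+ 2 * f 2 t + 36 * f 0 t * f 2 t ^+ 2 +
    48 * f 0 t * f 1 t * f 3 t + 6 * f 0 t ^+ 2 * f 4 t.
  apply: (derive_eq_on f5 d5) => t tc.
  have e0 := d0 t tc; have e1 := d1 t tc; have e2 := d2 t tc; have e3 := d3 t tc.
  by derive; move: (f 0 t) (f 1 t) (f 2 t) (f 3 t) (f 4 t) => *; ring.
have f7 : forall t, `|t| < c -> f 7 t =
    180 * f 1 t * f 2 t ^+ 2 + 120 * f 1 t ^+ 2 * f 3 t +
    120 * f 0 t * f 2 t * f 3 t + 60 * f 0 t * f 1 t * f 4 t +
    6 * f 0 t ^+ 2 * f 5 t.
  apply: (derive_eq_on f6 d6) => t tc.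
  have e0 := d0 t tc; have e1 := d1 t tc; have e2 := d2 t tc; have e3 := d3 t tc.
  have e4 := d4 t tc.
  by derive; move: (f 0 t) (f 1 t) (f 2 t) (f 3 t) (f 4 t) (f 5 t) => *; ring.
have f8 : forall t, `|t| < c -> f 8 t =
    180 * f 2 t ^+ 3 + 720 * f 1 t * f 2 t * f 3 t + 120 * f 0 t * f 3 t ^+ 2 +
    180 * f 1 t ^+ 2 * f 4 t + 180 * f 0 t * f 2 t * f 4 t +
    72 * f 0 t * f 1 t * f 5 t + 6 * f 0 t ^+ 2 * f 6 t.
  apply: (derive_eq_on f7 d7) => t tc.
  have e0 := d0 t tc; have e1 := d1 t tc; have e2 := d2 t tc; have e3 := d3 t tc.
  have e4 := d4 t tc; have e5 := d5 t tc.
  by derive; move: (f 0 t) (f 1 t) (f 2 t) (f 3 t) (f 4 t) (f 5 t) (f 6 t) => *; ring.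
have z : `|0 : R| < c by rewrite normr0.
have o1 : f 1 0 = 0 by exact: exp_moment_odd.
have o3 : f 3 0 = 0 by exact: exp_moment_odd.
have o5 : f 5 0 = 0 by exact: exp_moment_odd.
(* Without the terms containing a derivative of odd order, the coefficients are 12 = 6·2, 216 =
   36·2^2 + 6·12 and 7056 = 180·2^3 + 180·2·12 + 6·216. *)
have := f2 0 z; have := f4 0 z; have := f6 0 z; have := f8 0 z.
rewrite o1 o3 o5; move: (f 0 0) (f 2 0) (f 4 0) (f 6 0) (f 8 0).
move=> x0 x2 x4 x6 x8 -> -> -> ->; split => //; ring.
Qed.

End lemniscatic_case.

(** * Moments *)

Section expectation.
Context {R : realType} {d : measure_display} {Omega : measurableType d}.
Variables (P : probability Omega R) (Y : {RV P >-> int}).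

(** Countable additivity is used along the fibres of [pickle (Y w)], indexed by [nat]; codes outside
    the range of [pickle] have empty fibres, and the others are reindexed by [int]. All preimages
    are measurable since [int] carries its power set. *)
Lemma integral_discrete (h : int -> R) : (forall k, 0 <= h k) ->
  (\int[P]_w (h (Y w))%:E =
   \esum_(k in [set: int]) ((h k)%:E * P [set w | Y w = k]))%E.
Proof.
move=> h0.
pose F (n : nat) : set Omega := [set w | pickle (Y w) = n].
have mA (A : set int) : measurable (Y @^-1` A).
  by rewrite -[X in measurable X]setTI; exact: measurable_funPT.
have mF n : measurable (F n) by exact: (mA [set k | pickle k = n]).
have UF : \bigcup_n F n = setT.
  by apply/seteqP; split => // w _; exists (pickle (Y w)).
have tF : trivIset setT F.
  by move=> i j _ _ [w [/= <- <-]].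
pose H (w : Omega) : \bar R := (h (Y w))%:E.
have mh : measurable_fun [set: Omega] H.
  by move=> _ B mB; rewrite setTI; exact: (mA [set k | B (h k)%:E]).
rewrite -UF ge0_integral_bigcup//; last 2 first.
- by rewrite UF.
- by move=> w _; rewrite lee_fin.
have G0 n : (0 <= \int[P]_(w in F n) (h (Y w))%:E)%E.
  by apply: integral_ge0 => w _; rewrite lee_fin.
rewrite nneseries_esumT//.
transitivity (\esum_(n in range (@pickle int)) \int[P]_(w in F n) (h (Y w))%:E)%E.
  rewrite [RHS]esum_mkcond; apply: eq_esum => n _; case: ifPn => // nr.
  rewrite (_ : F n = set0) ?integral_set0//.
  apply/seteqP; split => // w Fw; move: nr; rewrite notin_setE; apply.
  by exists (Y w).
have bij : set_bij [set: int] (range (@pickle int)) (@pickle int).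
  by split => // x y _ _; exact: (pcan_inj pickleK).
rewrite (reindex_esum _ _ _ _ bij); apply: eq_esum => k _.
have Fk : F (pickle k) = [set w | Y w = k].
  apply/seteqP; split => w /=; last by move=> <-.
  by move=> /(pcan_inj pickleK).
rewrite Fk (eq_integral (fun=> (h k)%:E)); last first.
  by move=> w; rewrite inE/= => ->.
by rewrite integral_cst// -Fk.
Qed.

End expectation.

Section moments.
Context {R : realType} {d : measure_display} {Omega : measurableType d}.
Variables (P : probability Omega R) (Y : {RV P >-> int}) (g : R).
Hypothesis hY : forall k : int,
  P [set w | Y w = k] = (g^-1 * sech (pi / 2 * (2 * k + 1)%:~R))%:E.
Local Notation a := (sech_seq (pi / 2 : R)).

Let pihalf_gt0 : 0 < pi / 2 :> R.
Proof. by rewrite divr_gt0// pi_gt0. Qed.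

(** [g] is an arbitrary normalising constant here, so its sign is read off from the probability of
    the event Y = 0. *)
Let ginv_ge0 : 0 <= g^-1.
Proof.
have : (0 <= (g^-1 * sech (pi / 2 * (2 * (0 : int)%R + 1)%:~R))%:E)%E.
  by rewrite -hY; exact: measure_ge0.
by rewrite lee_fin pmulr_lge0// sech_gt0.
Qed.

Lemma integral_sech (h : int -> R) : (forall k, 0 <= h k) ->
  abs_summable (fun k => a k * h k) ->
  (\int[P]_w (h (Y w))%:E = (g^-1 * psum (fun k => a k * h k))%:E)%E.
Proof.
move=> h0 hs.
have ah0 k : 0 <= a k * h k by rewrite mulr_ge0// ltW// sech_seq_gt0.
rewrite integral_discrete// EFinM psumK// -esumZl//.
by apply: eq_esum => k _; rewrite hY -EFinM mulrC mulrA.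
Qed.

Lemma total_mass : g = psum a.
Proof.
have a1 : (fun k => a k * 1) = a by apply/funext => k; rewrite mulr1.
have as1 : abs_summable (fun k => a k * 1).
  by rewrite a1; exact: sech_seq_summable.
have := integral_sech (fun=> ler01) as1.
rewrite integral_cst// [X in (_ * X)%E = _]probability_setT mule1 => -[].
(* With the convention that 0 has inverse 0, [g = 0] would give total mass 0. *)
rewrite a1 => e; have g0 : g != 0.
  by apply: contra_eq_neq e => ->; rewrite invr0 mul0r oner_neq0.
by apply: (mulfI (invr_neq0 g0)); rewrite mulVf.
Qed.

Lemma expectation_even_power (j : nat) : ~~ odd j ->
  ('E_P[(fun w => (2 * Y w + 1)%:~R ^+ j)%R] =
   (g^-1 * exp_moment (pi / 2) j 0)%:E)%E.
Proof.
move=> oj; rewrite unlock.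
have h0 (k : int) : 0 <= odd_int k ^+ j :> R by rewrite exprn_even_ge0.
have z : `|0 : R| < pi / 2 by rewrite normr0.
have e : (fun k => a k * (odd_int k ^+ j * expR (odd_int k * 0))) =
    (fun k => a k * (odd_int k ^+ j : R)).
  by apply/funext => k; rewrite mulr0 expR0 mulr1.
rewrite /exp_moment e; apply: (integral_sech h0).
by rewrite -e; exact: exp_moment_summable.
Qed.

End moments.

Unset Implicit Arguments.

Theorem theorem4p1 (R : realType) (d : measure_display)
    (Omega : measurableType d) (P : probability Omega R)
    (Y : {RV P >-> int})
    (hY : forall k : int,
      P [set w | Y w = k] =
        ((gauss R)^-1 * sech (pi / 2 * (2 * k + 1)%:~R))%:E) :
  [/\ ('E_P[(fun w => (2 * Y w + 1)%:~R ^+ 2)%R])%E = (2 * gauss R ^+ 2)%:E,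
      ('E_P[(fun w => (2 * Y w + 1)%:~R ^+ 4)%R])%E = (12 * gauss R ^+ 4)%:E,
      ('E_P[(fun w => (2 * Y w + 1)%:~R ^+ 6)%R])%E = (216 * gauss R ^+ 6)%:E &
      ('E_P[(fun w => (2 * Y w + 1)%:~R ^+ 8)%R])%E = (7056 * gauss R ^+ 8)%:E].
Proof.
have [m2 m4 m6 m8] := @even_moments R.
have g0 : gauss R = exp_moment (pi / 2) 0 0.
  by rewrite exp_moment_sum0; exact: total_mass hY.
have gn0 : gauss R != 0.
  rewrite g0 gt_eqF// exp_moment_even_gt0// ?normr0; have := pi_gt0 R; lra.
rewrite !(expectation_even_power hY)// m2 m4 m6 m8 -g0.
by move: (gauss R) gn0 => G G0; split; congr EFin; field.
Qed.
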